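(* Let $\mathbb M$ be a Carnot manifold with $C^1$ local basis vector fields $X_1,\dots,X_N$ and let $U$ be a compact domain in $\mathbb M$ on which the quasimetric $d_\infty$ is defined. There exists a constant $Q=Q(U)$ such that the inequality $$d_\infty(u,v)\le Q\bigl(d_\infty(u,w)+d_\infty(w,v)\bigr)$$ holds for every triple of points $u,w,v\in U$, where $Q(U)$ depends on $U$.
   Context: Carnot manifold: $\mathbb M$ is a connected Riemannian $C^\infty$-manifold of dimension $N$, whose tangent bundle has a (horizontal) subbundle $H\mathbb M$ together with natural numbers $\dim H_1<\dots<\dim H_M=N$ such that each point $p\in\mathbb M$ has a neighborhood $U$ with $C^1$ vector fields $X_1,\dots,X_N$ on $U$ satisfying for every $v\in U$: (1) $X_1(v),\dots,X_N(v)$ is a basis of $T_v\mathbb M$; (2) $H_i(v)=\operatorname{span}\{X_1(v),\dots,X_{\dim H_i}(v)\}$ is a subspace of dimension $\dim H_i$, $i=1,\dots,M$, and $H_1(v)=H_v\mathbb M$; (3) $[X_i,X_j](v)=\sum_{\deg X_k\le\deg X_i+\deg X_j}c_{ijk}(v)X_k(v)$, where $\deg X_k=\min\{m\mid X_k\in H_m\}$; (4) the quotient mapping $[\cdot,\cdot]_0:H_1\times H_j/H_{j-1}\to H_{j+1}/H_j$ induced by Lie brackets is an epimorphism for all $1\le j<M$. Let $\theta_u(v_1,\dots,v_N)=\exp(\sum v_iX_i)(u)$, a $C^1$-diffeomorphism of a Euclidean ball $B_E(0,r_u)$ ($r_u>0$) onto its image. The compactly embedded neighborhood $U$ under consideration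 is such that $U\subset\theta_u(B_E(0,r_u))$ for all $u\in U$. For $u,v\in U$ with $v=\exp(\sum v_iX_i)(u)$ put $d_\infty(u,v)=\max_i|v_i|^{1/\deg X_i}$. *)

(* Defs.v *)
From HB Require Import structures.
From mathcomp Require Import all_boot all_order all_algebra.
From mathcomp Require Import all_classical all_reals all_analysis.
Set Implicit Arguments.
Unset Strict Implicit.
Unset Printing Implicit Defensive.
Import Order.TTheory GRing.Theory Num.Theory.
Import numFieldNormedType.Exports.
Local Open Scope classical_set_scope.
Local Open Scope ring_scope.

Section Euclidean.
Context {R : realType}.

(* Meant for open A: f is total, but only its values on A matter. *)
Fixpoint Ck (n m k : nat) (A : set 'rV[R]_n) (f : 'rV[R]_n -> 'rV[R]_m) : Prop :=
  if k is k'.+1 then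
    (forall x, A x -> differentiable f x) /\
    (forall i : 'I_n, Ck k' A (fun x => 'D_(delta_mx 0 i) f x))
  else forall x, A x -> {for x, continuous f}.

Definition smooth (n m : nat) (A : set 'rV[R]_n) (f : 'rV[R]_n -> 'rV[R]_m) : Prop :=
  forall k, Ck k A f.

(* The norm of 'rV[R]_n in the library is the sup norm. *)
Definition eball (n : nat) (r : R) : set 'rV[R]_n :=
  [set a | Num.sqrt (\sum_(i < n) a 0 i ^+ 2) < r].

End Euclidean.

(* A C^oo manifold is given by a C^oo atlas; chart c is the homeomorphism
   phi c from cdom c onto its open image, with inverse psi c. *)
Record smooth_manifold (R : realType) (N : nat) := SmoothManifold {
  carrier :> topologicalType;
  chart : Type;
  cdom : chart -> set carrier;
  phi : chart -> carrier -> 'rV[R]_N;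
  psi : chart -> 'rV[R]_N -> carrier;
  chart_at : carrier -> chart;
  manifold_hausdorff : hausdorff_space carrier;
  manifold_second_countable : @second_countable carrier;
  chart_at_dom : forall p, cdom (chart_at p) p;
  open_cdom : forall c, open (cdom c);
  open_cimage : forall c, open (phi c @` cdom c);
  phiK : forall c p, cdom c p -> psi c (phi c p) = p;
  phi_continuous : forall c p, cdom c p -> {for p, continuous (phi c)};
  psi_continuous : forall c x, (phi c @` cdom c) x -> {for x, continuous (psi c)};
  transition_smooth : forall c d,
    smooth (phi c @` (cdom c `&` cdom d)) (phi d \o psi c)
}.

Section Manifold.
Context {R : realType} {N : nat} (M : smooth_manifold R N).

(* T_p M is the space of coordinate vectors in the preferred chart at p; a
   tangent vector has coordinates in every other chart around p through the
   differential of the transition map. *)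
Definition tangent (p : M) : Type := 'rV[R]_N.

Definition tangent_coord (p : M) (c : chart M) (v : tangent p) : 'rV[R]_N :=
  'd (phi c \o psi (chart_at p)) (phi (chart_at p) p) v.

Definition tangent_of_coord (p : M) (c : chart M) (w : 'rV[R]_N) : tangent p :=
  'd (phi (chart_at p) \o psi c) (phi c p) w.

Definition vfield := forall p : M, tangent p.

Definition vf_coord (X : vfield) (c : chart M) (x : 'rV[R]_N) : 'rV[R]_N :=
  tangent_coord c (X (psi c x)).

Definition vf_C1 (W : set M) (X : vfield) : Prop :=
  forall c, Ck 1 (phi c @` (cdom c `&` W)) (vf_coord X c).

(* In coordinates [X, Y] = DY(X) - DX(Y). *)
Definition lie_bracket (X Y : vfield) : vfield := fun p =>
  let c := chart_at p in
  'D_(X p : 'rV[R]_N) (vf_coord Y c) (phi c p)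
  - 'D_(Y p : 'rV[R]_N) (vf_coord X c) (phi c p).

(* An integral curve over [0, 1] inside W; the two-sided derivatives at the
   endpoints are no restriction, since W is open. *)
Definition integral_curve (W : set M) (V : vfield) (g : R -> M) : Prop :=
  forall t : R, 0 <= t <= 1 ->
    [/\ W (g t), {for t, continuous g} &
        is_derive (t : R^o) (1 : R^o)
          ((fun s => phi (chart_at (g t)) (g s)) : R^o -> 'rV[R]_N)
          (V (g t) : 'rV[R]_N)].

Definition flow_to (W : set M) (V : vfield) (u v : M) : Prop :=
  exists g : R -> M, [/\ integral_curve W V g, g 0 = u & g 1 = v].

(* exp(V)(u); equal to u by convention if the flow does not reach time 1. *)
Definition vexp (W : set M) (V : vfield) (u : M) : M := xget u [set v | flow_to W V u v].

Definition comb (X : 'I_N -> vfield) (a : 'rV[R]_N) : vfield := fun p =>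
  (\sum_(i < N) a 0 i *: (X i p : 'rV[R]_N))%R.

Definition theta (W : set M) (X : 'I_N -> vfield) (u : M) (a : 'rV[R]_N) : M :=
  vexp W (comb X a) u.

Definition C1_diffeo_onto_image (B : set 'rV[R]_N) (f : 'rV[R]_N -> M) : Prop :=
  [/\ open (f @` B),
      forall a, B a -> {for a, continuous f},
      forall c, Ck 1 (B `&` f @^-1` cdom c) (phi c \o f) &
      exists g : M -> 'rV[R]_N,
        (forall a, B a -> g (f a) = a) /\
        (forall c, Ck 1 (phi c @` (cdom c `&` f @` B)) (g \o psi c))].

Definition compact_domain (U : set M) : Prop :=
  compact U /\
  exists D : set M, [/\ open D, D !=set0, connected D & U = closure D].

End Manifold.

Record riemannian_manifold (R : realType) (N : nat) := RiemannianManifold {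
  rbase :> smooth_manifold R N;
  metric : forall p : rbase, tangent p -> tangent p -> R;
  metric_linear : forall (p : rbase) (a : R) (v w z : 'rV[R]_N),
    metric (a *: v + w : tangent p) z = a * metric (v : tangent p) z
                                        + metric (w : tangent p) z;
  metric_sym : forall (p : rbase) (v w : tangent p), metric v w = metric w v;
  metric_pos : forall (p : rbase) (v : 'rV[R]_N),
    v != 0 -> 0 < metric (v : tangent p) v;
  metric_smooth : forall (c : chart rbase) (i j : 'I_N),
    smooth (phi c @` cdom c) (fun x => const_mx
      (metric (tangent_of_coord (psi c x) c (delta_mx 0 i))
              (tangent_of_coord (psi c x) c (delta_mx 0 j))) : 'rV[R]_1)
}.

Section Frames.
Context {R : realType} {N : nat} (M : smooth_manifold R N).
Variables (hdim : nat -> nat) (depth : nat).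
Variables (W : set M) (X : 'I_N -> vfield M).

(* H_m(p), for 1 <= m <= depth. *)
Definition Hspan (m : nat) (p : M) : {vspace 'rV[R]_N} :=
  (<<[seq (X k p : 'rV[R]_N) | k : 'I_N <- enum 'I_N & (k < hdim m)%N]>>)%VS.

(* find is relative to the list [1; ...; depth], whence the successor. *)
Definition deg (k : 'I_N) : nat :=
  (find (fun m => `[< forall p, W p -> (X k p : 'rV[R]_N) \in Hspan m p >])
        (iota 1 depth)).+1.

(* The span of the representatives [X_i, X_k](p) of the values of
   [., .]_0 : H_1 x H_m/H_(m-1) -> H_(m+1)/H_m. *)
Definition bracket_span (m : nat) (p : M) : {vspace 'rV[R]_N} :=
  (<<[seq (lie_bracket (X i) (X k) p : 'rV[R]_N)
       | i : 'I_N <- [seq i : 'I_N <- enum 'I_N | (i < hdim 1)%N],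
         k : 'I_N <- [seq k : 'I_N <- enum 'I_N | (k < hdim m)%N]]>>)%VS.

(* The bilinear map [., .]_0 is an epimorphism when the span of its values is
   all of H_(m+1)/H_m; this is the last clause, lifted from the quotient. *)
Definition carnot_frame (HM : forall p : M, {vspace 'rV[R]_N}) : Prop :=
  (forall k, vf_C1 W (X k)) /\
  (forall p, W p ->
   [/\ basis_of fullv [seq (X k p : 'rV[R]_N) | k : 'I_N <- enum 'I_N],
       (forall m, (1 <= m <= depth)%N -> \dim (Hspan m p) = hdim m)
       /\ Hspan 1 p = HM p,
       exists c : 'I_N -> 'I_N -> 'I_N -> R, forall i j,
         lie_bracket (X i) (X j) p =
         \sum_(k < N | (deg k <= deg i + deg j)%N) c i j k *: (X k p : 'rV[R]_N)
       & forall m, (1 <= m < depth)%N ->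
           Hspan m.+1 p = (Hspan m p + bracket_span m p)%VS]).

End Frames.

(* HM p is the fibre at p of the horizontal subbundle; that the fibres form a
   subbundle is part of local_frames. *)
Record carnot_manifold (R : realType) (N : nat) := CarnotManifold {
  cbase :> riemannian_manifold R N;
  HM : forall p : cbase, {vspace 'rV[R]_N};
  depth : nat;
  hdim : nat -> nat;
  carnot_connected : connected [set: cbase];
  depth_gt0 : (0 < depth)%N;
  hdim1_gt0 : (0 < hdim 1)%N;
  hdim_incr : forall m, (1 <= m < depth)%N -> (hdim m < hdim m.+1)%N;
  hdim_depth : hdim depth = N;
  local_frames : forall p : cbase, exists (W : set cbase) (X : 'I_N -> vfield cbase),
    [/\ open W, W p & carnot_frame hdim depth W X HM]
}.

Section Quasimetric.
Context {R : realType} {N : nat} (M : carnot_manifold R N).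
Variables (W : set M) (X : 'I_N -> vfield M) (r : M -> R).

(* d_oo is defined on U: each theta_u is a C^1-diffeomorphism of the ball
   B_E(0, r u) onto its image, and that image contains U. *)
Definition dinfty_defined (U : set M) : Prop :=
  forall u, U u ->
    [/\ 0 < r u,
        forall a, eball (r u) a -> exists v, flow_to W (comb X a) u v,
        C1_diffeo_onto_image (eball (r u)) (theta W X u) &
        U `<=` theta W X u @` eball (r u)].

Definition theta_coord (u v : M) : 'rV[R]_N :=
  xget 0 [set a | eball (r u) a /\ theta W X u a = v].

Definition dinfty (u v : M) : R :=
  \big[Num.max/0]_(i < N)
    (`|theta_coord u v 0 i| `^ ((deg (hdim M) (depth M) W X i)%:R^-1)).

End Quasimetric.

(* Main.v *)
Require Import Defs.
From mathcomp Require Import all_boot all_order all_algebra.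
From mathcomp Require Import all_classical all_reals all_analysis.
From mathcomp Require Import lra ring.
Set Implicit Arguments.
Unset Strict Implicit.
Unset Printing Implicit Defensive.
Import Order.TTheory GRing.Theory Num.Theory.
Import numFieldNormedType.Exports.
Local Open Scope classical_set_scope.
Local Open Scope ring_scope.

(** * The generalized triangle inequality for d_oo on a Carnot manifold

    Since [U] is compact, it is enough to find, for every [u0] in [U], a constant
    that works for all [u] in [U] near [u0] and all [w], [v] in [U]
    ([quasi_triangle_near]).

    When the right-hand side is not small, the inequality says that the
    coordinates of [v] relative to [u] are bounded ([coord_bounded]).  The radius
    [r u] depends on [u] in an arbitrary way, but if it is smaller than [r u0] the
    bound [r u0] is immediate, and otherwise [theta_u] is defined on a closed ball
    around the coordinates of [v0] relative to [u0], on which it is uniformly close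
    to [theta_u0] by continuous dependence on the initial point
    ([flow_continuous]).  The image of the bounding sphere then stays away from
    [v0], so that by connectedness the open image of the ball contains a whole
    neighbourhood of [v0] ([coord_bounded_at]).

    When the right-hand side is small, let [w = exp(a)(u)] and [v = exp(b)(w)] with
    [|a_i|, |b_i| <= ka eps^(deg i)], and lift the path [s |-> exp(s b)(w)] through
    [theta_u] to a path [s |-> a(s)] of coordinates starting at [a].  The claim is
    that [a(s)] moves with speed at most [3 ka] for the weighted norm
    [max_l |y_l| / eps^(deg l)], uniformly in [eps <= 1] ([lift_step],
    [local_triangle]).  The reason is the equation of variations.  Write the
    variation of [exp(t c)(u)] in the direction [y] in the moving frame as
    [sum_k z_k(t) X_k], and [[X_k, X_i] = sum_l C_kil X_l]; then
      [z_l' = y_l + sum_(k, i) z_k c_i C_kil],  [z(0) = 0].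
    As the fields are of class C^1, the functions [C_kil] are locally bounded, and
    [C_kil = 0] unless [deg l <= deg k + deg i].  Hence, if [|c_i| <= eta eps^(deg i)],
    the second term has weighted norm at most a constant times [eta |z|], whatever
    [eps] is, so that for small [eta] the map from [y] to [z(1)] is close to the
    identity ([coefficients_le]).  Expanding the brackets in the coordinates of one fixed
    chart uses their invariance under a change of chart, that is, the symmetry
    of second derivatives ([schwarz], [bracket_pushforward]). *)

(** * Linear identities in modules *)
Section ModuleIdentities.

(** Reified linear combinations: two of them agree on every valuation when all
    their coefficients agree, which leaves identities of scalars to [ring]. *)
Inductive mexp (K : Type) : Type :=
  | MVar of nat | MZero | MAdd of mexp K & mexp K | MOpp of mexp K
  | MScale of K & mexp K.

Context {K : nzRingType} {V : lmodType K}.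

Fixpoint meval (env : seq V) (e : mexp K) : V :=
  match e with
  | MVar n => nth 0 env n
  | MZero => 0
  | MAdd a b => meval env a + meval env b
  | MOpp a => - meval env a
  | MScale k a => k *: meval env a
  end.

Fixpoint mcoef (e : mexp K) (k : nat) : K :=
  match e with
  | MVar n => if Nat.eqb n k then 1 else 0
  | MZero => 0
  | MAdd a b => mcoef a k + mcoef b k
  | MOpp a => - mcoef a k
  | MScale c a => c * mcoef a k
  end.

Lemma mevalE env e : meval env e = \sum_(k < size env) mcoef e k *: nth 0 env k.
Proof.
elim: e => /= [n||a -> b ->|a ->|c a ->].
- have [ns|ns] := ltnP n (size env).
    rewrite (bigD1 (Ordinal ns)) //= PeanoNat.Nat.eqb_refl scale1r big1 ?addr0 // => i.
    rewrite -val_eqE /= => /eqP ni.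
    case: (PeanoNat.Nat.eqb_spec n i) => [nE|_]; first by case: ni.
    by rewrite scale0r.
  rewrite nth_default // big1 // => i _.
  case: (PeanoNat.Nat.eqb_spec n i) => [nE|_]; last by rewrite scale0r.
  by move: (ltn_ord i); rewrite -nE ltnNge ns.
- by rewrite big1 // => i _; rewrite scale0r.
- by rewrite -big_split; apply: eq_bigr => i _; rewrite scalerDl.
- by rewrite -sumrN; apply: eq_bigr => i _; rewrite scaleNr.
- by rewrite scaler_sumr; apply: eq_bigr => i _; rewrite scalerA.
Qed.

Fixpoint all_coef_eq (e1 e2 : mexp K) (n : nat) : Prop :=
  match n with
  | 0%N => True
  | S m => mcoef e1 m = mcoef e2 m /\ all_coef_eq e1 e2 m
  end.

Lemma meval_eq env e1 e2 :
  all_coef_eq e1 e2 (size env) -> meval env e1 = meval env e2.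
Proof.
move=> H; rewrite !mevalE; apply: eq_bigr => i _; congr (_ *: _).
elim: (size env) H i => [_ []//|n IH /= [H1 H2] i].
have := ltn_ord i; rewrite ltnS leq_eqVlt => /orP[/eqP -> //|ni].
exact: (IH H2 (Ordinal ni)).
Qed.

End ModuleIdentities.

Ltac mlookup x env :=
  match env with
  | nil => fail 1
  | ?y :: ?env' =>
    match goal with
    | _ => let _ := match goal with _ => constr_eq x y end in constr:(0%N)
    | _ => let n := mlookup x env' in constr:(S n)
    end
  end.

Ltac mappend x env :=
  match env with
  | nil => constr:(x :: nil)
  | ?y :: ?env' => let r := mappend x env' in constr:(y :: r)
  end.

Ltac mvar_add x env :=
  match goal with
  | _ => let _ := mlookup x env in env
  | _ => mappend x env
  end.

Ltac mvars t env :=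
  match t with
  | (?a + ?b)%R => let env1 := mvars a env in mvars b env1
  | (- ?a)%R => mvars a env
  | (?k *: ?a)%R => mvars a env
  | 0%R => env
  | _ => mvar_add t env
  end.

Ltac mreify K t env :=
  match t with
  | (?a + ?b)%R => let x := mreify K a env in let y := mreify K b env in
      constr:(@MAdd K x y)
  | (- ?a)%R => let x := mreify K a env in constr:(@MOpp K x)
  | (?k *: ?a)%R => let x := mreify K a env in constr:(@MScale K k x)
  | 0%R => constr:(@MZero K)
  | _ => let n := mlookup t env in constr:(@MVar K n)
  end.

(** Proves an equality between linear combinations of vectors with coefficients
    in [K]; vectors that are not syntactically equal are different atoms. *)
Ltac lmodule K :=
  match goal with
  | |- @eq ?V ?a ?b =>
    let env0 := mvars a (@nil V) in
    let env := mvars b env0 in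
    let e1 := mreify K a env in
    let e2 := mreify K b env in
    apply: (@meval_eq _ _ env e1 e2); cbn [all_coef_eq mcoef size Nat.eqb];
    repeat split; try ring
  end.

(** * Real induction *)
Section RealInduction.
Context {R : realType}.

(** The supremum of the points up to which [P] holds is reached by the last
    hypothesis and cannot be smaller than [b] by the second one.  It replaces
    the connectedness of the interval, and unlike it allows the two steps to
    use [P] on everything to the left. *)
Lemma real_induction (a b : R) (P : R -> Prop) :
  P a ->
  (forall t, a <= t < b -> (forall s, a <= s <= t -> P s) ->
     \forall s \near t, t < s <= b -> P s) ->
  (forall t, a < t <= b -> (forall s, a <= s < t -> P s) -> P t) ->
  forall t, a <= t <= b -> P t.
Proof.
move=> Pa Pr Pl t1 /andP[at1 t1b].
have ab : a <= b by apply: le_trans t1b.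
pose S := [set t | a <= t <= b /\ forall s, a <= s <= t -> P s].
have Sa : S a.
  split; first by rewrite lexx.
  by move=> s /andP[s1 s2]; have -> : s = a by apply/eqP; rewrite eq_le s1 s2.
have Sub : ubound S b by move=> x [/andP[_ ]].
have hS : has_sup S by split; [exists a | exists b].
pose m := sup S.
have am : a <= m by apply: sup_upper_bound.
have mb : m <= b by apply: ge_sup => //; exists a.
have Plt s : a <= s < m -> P s.
  move=> /andP[as_ sm].
  have [x [_ Sx] xs] := @sup_adherent R S (m - s) ltac:(by rewrite subr_gt0) hS.
  by apply: Sx; rewrite as_ ltW //; rewrite -/m opprB addrC subrK in xs.
have Pm : P m.
  move: am; rewrite le_eqVlt => /orP[/eqP <- //|am].
  by apply: Pl => //; rewrite am.
have Ple s : a <= s <= m -> P s.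
  move=> /andP[as_]; rewrite le_eqVlt => /orP[/eqP -> //|sm].
  by apply: Plt; rewrite as_ sm.
have [mb'|bm] := ltP m b; last first.
  by apply: Ple; rewrite at1 (le_trans t1b).
have := Pr m; rewrite am mb' => /(_ isT Ple) /nbhs_ballP [e /= e0 he].
pose s := Num.min b (m + e / 2).
have ms : m < s by rewrite lt_min mb' ltrDl divr_gt0.
have : S s.
  split; first by rewrite (le_trans am (ltW ms)) ge_min lexx.
  move=> s' /andP[as' s's].
  have [s'm|ms'] := leP s' m; first by apply: Ple; rewrite as'.
  apply: he; last by rewrite ms' (le_trans s's) // ge_min lexx.
  rewrite /ball /= ltr_distlC; apply/andP; split; first lra.
  have : s <= m + e / 2 by rewrite ge_min lexx orbT.
  lra.
move=> /(sup_upper_bound hS); rewrite leNgt -/m => /negP; case.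
by [].
Qed.

End RealInduction.

(** * Derivatives of curves and mean value inequality *)
Section Derivatives.
Context {R : realType}.
Implicit Types V W : normedModType R.

(** The derivative of a curve as an estimate with explicit error, the form in
    which it is used in every inequality below. *)
Definition has_deriv V (g : R -> V) (t : R) (d : V) :=
  forall e, 0 < e -> \forall s \near t, `|g s - g t - (s - t) *: d| <= e * `|s - t|.

(** The differential behind a sealed constant: unification of differentials at
    two different points would otherwise unfold the matrix topology. *)
Definition sdiff_spec : {D : forall V W : normedModType R, (V -> W) -> V -> V -> W |
  forall V W f x v, D V W f x v = 'd f x v}.
Proof. by exists (fun V W f x v => 'd f x v). Qed.

Definition sdiff V W : (V -> W) -> V -> V -> W := sval sdiff_spec V W.

Lemma sdiffE V W (f : V -> W) x v : sdiff f x v = 'd f x v.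
Proof. exact: (svalP sdiff_spec). Qed.

Lemma sdiff_funE V W (f : V -> W) x : sdiff f x = 'd f x.
Proof. by apply/funext => v; exact: sdiffE. Qed.

Section DiffLinear.
Context {V W : normedModType R} (f : V -> W) (x : V).
Lemma sdiffB a b : sdiff f x (a - b) = sdiff f x a - sdiff f x b.
Proof. by rewrite sdiff_funE linearB. Qed.
Lemma sdiffD a b : sdiff f x (a + b) = sdiff f x a + sdiff f x b.
Proof. by rewrite sdiff_funE linearD. Qed.
Lemma sdiffZ k a : sdiff f x (k *: a) = k *: sdiff f x a. Proof. by rewrite sdiff_funE linearZ. Qed.
Lemma sdiff_sum (I : Type) (r : seq I) (P : pred I) E :
  sdiff f x (\sum_(i <- r | P i) E i) = \sum_(i <- r | P i) sdiff f x (E i).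
Proof. by rewrite sdiff_funE linear_sum. Qed.
Lemma derive_sdiff v : differentiable f x -> 'D_v f x = sdiff f x v.
Proof. by move=> df; rewrite sdiff_funE; exact: deriveE. Qed.
End DiffLinear.

Lemma differentiable_approx V W (f : V -> W) (x : V) : differentiable f x ->
  forall e, 0 < e -> \forall y \near x,
    `|f y - f x - sdiff f x (y - x)| <= e * `|y - x|.
Proof.
move=> /diff_locallyP[_ /eqaddoP fE] e e0; rewrite sdiff_funE.
have := fE e e0; rewrite /= !near_simpl => h.
have {}h : \forall y \near (0 : V), `|f (y + x) - f x - 'd f x y| <= e * `|y|.
  move: h; apply: filterS => y.
  by rewrite ?sdiff_funE -[(_ - _ : V -> W) y]/(_ y - _ y) /= opprD addrA.
move: h; rewrite (near_shift x 0); apply: filterS => y /=.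
by rewrite sub0r subrK.
Qed.

Lemma near_dist V (x : V) e : 0 < e -> \forall y \near x, `|y - x| < e.
Proof.
by move=> e0; apply/nbhs_ballP; exists e => //= y; rewrite -ball_normE /= distrC.
Qed.

Lemma near_distP V (x : V) (P : V -> Prop) :
  (\forall y \near x, P y) <-> exists2 e, 0 < e & forall y, `|y - x| < e -> P y.
Proof.
split=> [/nbhs_ballP[e /= e0 he]|[e e0 he]].
  by exists e => // y ye; apply: he; rewrite -ball_normE /= distrC.
by near=> y; apply: he; near: y; exact: near_dist.
Unshelve. all: by end_near. Qed.

Lemma near_distR (t : R) (P : R -> Prop) :
  (\forall y \near t, P y) -> exists2 e, 0 < e & forall y, `|y - t| < e -> P y.
Proof. exact: (iffLR (@near_distP R^o t P)). Qed.

Lemma has_deriv_is_derive V (g : R -> V) t d :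
  is_derive (t : R^o) (1 : R^o) (g : R^o -> V) d -> has_deriv g t d.
Proof.
move=> [dg <-] e e0.
have dfg : differentiable (g : R^o -> V) t by apply/derivable1_diffP.
have := differentiable_approx dfg e0; apply: filterS => s.
rewrite (_ : sdiff (g : R^o -> V) t (s - t) = (s - t) *: 'D_(1 : R^o) (g : R^o -> V) t) //.
rewrite derive_sdiff // -sdiffZ; congr (sdiff _ _ _).
by rewrite /GRing.scale /= mulr1.
Qed.

Lemma diff_bound V W (f : V -> W) (x : V) : differentiable f x ->
  exists2 k, 0 < k & forall v, `|sdiff f x v| <= k * `|v|.
Proof. by move=> df; rewrite sdiff_funE; apply: linear_lipschitz; apply: diff_continuous. Qed.

Lemma has_deriv_lip V (g : R -> V) t d (C : R) : has_deriv g t d -> `|d| < C ->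
  \forall s \near t, `|g s - g t| <= C * `|s - t|.
Proof.
move=> gd dC; have e0 : 0 < C - `|d| by rewrite subr_gt0.
have := gd _ e0; apply: filterS => s h.
rewrite -[g s - g t](subrK ((s - t) *: d)) (le_trans (ler_normD _ _)) //.
rewrite normrZ -[C](subrK `|d|) mulrDl lerD // mulrC //.
Qed.

Lemma has_deriv_cvg V (g : R -> V) t d : has_deriv g t d -> g x @[x --> t] --> g t.
Proof.
move=> gd; have C0 : 0 < `|d| + 1 by rewrite ltr_wpDl.
have := has_deriv_lip gd (C := `|d| + 1) ltac:(by rewrite ltrDl) => h.
apply/cvgrPdist_le => e e0.
have hh := near_dist (t : R^o) (e := e / (`|d| + 1)) ltac:(by rewrite divr_gt0).
near=> s; rewrite distrC (le_trans (near h s _)) //.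
rewrite mulrC -ler_pdivlMr // ltW //; near: s; exact: hh.
Unshelve. all: by end_near. Qed.

Lemma has_deriv_comp V W (f : V -> W) (g : R -> V) t d :
  has_deriv g t d -> differentiable f (g t) -> has_deriv (f \o g) t (sdiff f (g t) d).
Proof.
move=> gd df e e0.
have [k k0 kf] := diff_bound df.
pose C := `|d| + 1.
have C0 : 0 < C by rewrite ltr_wpDl.
have e1 : 0 < e / (C + C) by rewrite divr_gt0 // addr_gt0.
have e2 : 0 < e / (k + k) by rewrite divr_gt0 // addr_gt0.
have gl := has_deriv_lip gd (C := C) ltac:(by rewrite ltrDl).
have h1 := gd _ e2.
have h2 : \forall s \near t, `|f (g s) - f (g t) - sdiff f (g t) (g s - g t)| <=
   e / (C + C) * `|g s - g t|.
  exact: (has_deriv_cvg gd (differentiable_approx df e1)).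
move: h1 h2 gl; apply: filterS3 => s H1 H2 H3 /=.
rewrite (_ : _ - _ - _ = (f (g s) - f (g t) - sdiff f (g t) (g s - g t)) +
   sdiff f (g t) (g s - g t - (s - t) *: d)); last first.
  by rewrite (sdiffB _ _ _ ((s - t) *: d)) sdiffZ addrA subrK.
rewrite (le_trans (ler_normD _ _)) // [e in leRHS](splitr e) mulrDl lerD //.
  rewrite (le_trans H2) // (le_trans (ler_wpM2l (ltW e1) H3)) // mulrA.
  by rewrite le_eqVlt; apply/orP; left; apply/eqP; congr (_ * _); field; lra.
rewrite (le_trans (kf _)) // (le_trans (ler_wpM2l (ltW k0) H1)) //.
rewrite mulrA le_eqVlt; apply/orP; left; apply/eqP; congr (_ * _); field; lra.
Qed.

Lemma sdiff_comp (U V W : normedModType R) (f : U -> V) (g : V -> W) x y :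
  f x = y -> differentiable f x -> differentiable g y ->
  differentiable (g \o f) x /\ forall v, sdiff (g \o f) x v = sdiff g y (sdiff f x v).
Proof.
move=> <- df dg; split; first exact: differentiable_comp.
by move=> v; rewrite !sdiff_funE diff_comp.
Qed.

Lemma has_deriv_unique V (g : R -> V) t d1 d2 :
  has_deriv g t d1 -> has_deriv g t d2 -> d1 = d2.
Proof.
move=> h1 h2; apply/eqP; rewrite -subr_eq0 -normr_le0; apply/ler_addgt0Pr => e e0.
rewrite add0r.
have e2 : 0 < e / 2 by rewrite divr_gt0.
have [r r0 H] := near_distR (filterI (h1 _ e2) (h2 _ e2)).
have E : t + r / 2 - t = r / 2 by rewrite addrAC subrr add0r.
have [] := H (t + r / 2); first by rewrite E gtr0_norm; lra.
rewrite !E => H1 H2.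
have r20 : 0 < r / 2 by lra.
rewrite -(ler_pM2l r20) -[X in X * `|_|]gtr0_norm // -normrZ.
rewrite scalerBr.
rewrite (_ : _ - _ = (g (t + r / 2) - g t - (r / 2) *: d2) -
  (g (t + r / 2) - g t - (r / 2) *: d1)); last by rewrite opprB [RHS]addrC subrKA.
rewrite gtr0_norm // in H1 H2.
by rewrite (le_trans (ler_normB _ _)) //; move: (lerD H2 H1); lra.
Qed.

(** Only pointwise derivatives are needed: an increment bound with a slightly
    larger slope propagates by real induction. *)
Lemma mean_value V (g : R -> V) (a b : R) (d : R -> V) (e : V) (C : R) : a <= b ->
  (forall t, a <= t <= b -> has_deriv g t (d t) /\ `|d t - e| <= C) ->
  `|g b - g a - (b - a) *: e| <= C * (b - a).
Proof.
move=> ab gd.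
suff h K : C < K -> `|g b - g a - (b - a) *: e| <= K * (b - a).
  move: ab; rewrite le_eqVlt => /orP[/eqP ->|ab].
    by rewrite !subrr scale0r subr0 normr0 mulr0.
  have ab' : 0 < b - a by rewrite subr_gt0.
  rewrite -ler_pdivrMr //; apply/ler_addgt0Pr => x x0.
  by rewrite ler_pdivrMr // h // ltrDl.
move=> CK; pose P t := `|g t - g a - (t - a) *: e| <= K * (t - a).
have loc t : a <= t <= b ->
    \forall s \near t, `|g s - g t - (s - t) *: e| <= K * `|s - t|.
  move=> /gd[gt dt]; have KC : 0 < K - C by rewrite subr_gt0.
  have := gt _ KC; apply: filterS => s Hs.
  rewrite (_ : _ - _ - _ = (g s - g t - (s - t) *: d t) + (s - t) *: (d t - e)).
    rewrite (le_trans (ler_normD _ _)) // -[K](subrK C) mulrDl lerD //.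
    by rewrite normrZ mulrC ler_wpM2r.
  by rewrite scalerBr addrA subrK.
have chain s t : P t -> t <= s -> `|g s - g t - (s - t) *: e| <= K * `|s - t| -> P s.
  move=> Pt ts H; rewrite ger0_norm ?subr_ge0 // in H.
  rewrite /P (_ : g s - g a - (s - a) *: e = (g s - g t - (s - t) *: e) +
      (g t - g a - (t - a) *: e)).
    rewrite (le_trans (ler_normD _ _)) // (_ : s - a = (s - t) + (t - a)); last lra.
    by rewrite mulrDr lerD.
  rewrite (_ : s - a = (s - t) + (t - a)); last lra.
  by rewrite scalerDl opprD [RHS]addrACA subrKA.
suff : P b by [].
apply: (@real_induction R a b P) => [|t /andP[at_ tb] H|t /andP[at_ tb] H|].
- by rewrite /P !subrr scale0r subr0 normr0 mulr0.
- have := loc t; rewrite at_ ltW // => /(_ isT); apply: filterS => s Hs /andP[ts _].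
  by apply: chain Hs; [apply: H; rewrite at_ lexx|exact: ltW].
- have [r r0 Hr] := near_distR (loc t ltac:(by rewrite tb ltW)).
  pose s := Num.max a (t - r / 2).
  have as_ : a <= s by rewrite le_max lexx.
  have st : s < t by rewrite gt_max at_ /=; lra.
  have rs : t - r / 2 <= s by rewrite le_max lexx orbT.
  have Hs := Hr s; rewrite distrC gtr0_norm ?subr_gt0 // in Hs.
  have {}Hs := Hs ltac:(lra).
  apply: (@chain t s); [by apply: H; rewrite as_|exact: ltW|].
  rewrite -normrN (_ : - (g t - g s - (t - s) *: e) = g s - g t - (s - t) *: e).
    by rewrite gtr0_norm ?subr_gt0.
  by rewrite opprB opprB -[s - t]opprB scaleNr opprK addrC.
- by rewrite lexx ab.
Qed.

End Derivatives.

(** * Strict differentiability and symmetry of second derivatives *)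
Section Calculus.
Context {R : realType}.
Implicit Types V W : normedModType R.

Lemma row_norm_le n (v : 'rV[R]_n) (C : R) :
  0 <= C -> (forall i, `|v 0 i| <= C) -> `|v| <= C.
Proof.
move=> C0 H; rewrite /Num.norm/= mx_normrE; apply/bigmax_leP; split => //= -[i j] _ /=.
by rewrite ord1.
Qed.

Lemma row_norm_ge n (v : 'rV[R]_n) i : `|v 0 i| <= `|v|.
Proof.
rewrite [leRHS]/Num.norm /= mx_normrE; apply/bigmax_geP; right => /=.
by exists (0, i).
Qed.

Lemma norm_sumZ_le n V (a : 'rV[R]_n) (E : 'I_n -> V) (C : R) :
  (forall i, `|E i| <= C) -> `|\sum_i a 0 i *: E i| <= n%:R * C * `|a|.
Proof.
move=> H; rewrite (le_trans (ler_norm_sum _ _ _)) //.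
rewrite (le_trans (y := \sum_(i < n) C * `|a|)) //.
  by apply: ler_sum => i _; rewrite normrZ mulrC ler_pM // row_norm_ge.
by rewrite sumr_const card_ord -[leLHS]mulr_natl mulrA.
Qed.

Lemma diff_coordE n V (f : 'rV[R]_n -> V) x w :
  sdiff f x w = \sum_i w 0 i *: sdiff f x (delta_mx 0 i).
Proof.
rewrite {1}(row_sum_delta w) sdiff_sum; apply: eq_bigr => i _; exact: sdiffZ.
Qed.

Lemma has_deriv_line V (y w : V) (t : R) : has_deriv (fun s => y + s *: w) t w.
Proof.
move=> e e0; near=> s.
rewrite opprD addrACA subrr add0r -scalerBl subrr normr0.
by rewrite mulr_ge0 // ltW.
Unshelve. all: by end_near. Qed.

Lemma diff_near_cont n V (f : 'rV[R]_n -> V) x :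
  (\forall y \near x, differentiable f y) ->
  (forall i, {for x, continuous (fun y => 'D_(delta_mx 0 i) f y)}) ->
  forall e, 0 < e -> \forall y \near x, forall w, `|sdiff f y w - sdiff f x w| <= e * `|w|.
Proof.
move=> df cf e e0.
have dx : differentiable f x by exact: nbhs_singleton df.
have e1 : 0 < e / n.+1%:R by rewrite divr_gt0.
have : \forall y \near x, forall i,
    `|'D_(delta_mx 0 i) f y - 'D_(delta_mx 0 i) f x| <= e / n.+1%:R.
  apply: (@filter_forall _ _ (fun i y => `|'D_(delta_mx 0 i) f y - 'D_(delta_mx 0 i) f x| <= _) (nbhs x)) => i.
  have /cvgrPdist_le/(_ _ e1) := cf i; apply: filterS => y; by rewrite distrC.
move: df; apply: filterS2 => y dy H w.
rewrite (diff_coordE f y w) (diff_coordE f x w) -sumrB.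
under eq_bigr do rewrite -scalerBr.
rewrite (le_trans (norm_sumZ_le (C := e / n.+1%:R) _ _)) //.
  by move=> i; rewrite -!derive_sdiff.
rewrite ler_wpM2r // mulrC -mulrA ler_piMr ?(ltW e0) //.
by rewrite mulrC ler_pdivrMr // mul1r ler_nat.
Qed.

Lemma segment_in_ball V (x y z : V) e (t : R) : 0 <= t <= 1 -> `|y - x| < e -> `|z - x| < e ->
  `|y + t *: (z - y) - x| < e.
Proof.
move=> /andP[t0 t1] yr zr.
rewrite (_ : _ - x = (1 - t) *: (y - x) + t *: (z - x)); last by lmodule R.
rewrite (le_lt_trans (ler_normD _ _)) // !normrZ ger0_norm ?subr_ge0 // ger0_norm //.
move: t0; rewrite le_eqVlt => /orP[/eqP <-|t0].
  by rewrite subr0 mul1r mul0r addr0.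
rewrite (@lt_le_trans _ _ ((1 - t) * e + t * e)) //; last by rewrite -mulrDl subrK mul1r.
by rewrite ler_ltD // ?ltr_pM2l // ler_wpM2l ?subr_ge0 // ltW.
Qed.

(** On a segment near [x] the differential varies by less than [e], and the mean
    value inequality turns this into an estimate uniform in both end points. *)
Lemma strict_diff n V (f : 'rV[R]_n -> V) x :
  (\forall y \near x, differentiable f y) ->
  (forall i, {for x, continuous (fun y => 'D_(delta_mx 0 i) f y)}) ->
  forall e, 0 < e -> exists2 r, 0 < r & forall y z, `|y - x| < r -> `|z - x| < r ->
    `|f z - f y - sdiff f y (z - y)| <= e * `|z - y|.
Proof.
move=> df cf e e0.
have e2 : 0 < e / 2 by rewrite divr_gt0.
have [r r0 H] := iffLR (near_distP _ _) (filterI df (diff_near_cont df cf e2)).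
exists r => // y z yr zr.
pose g (t : R) := f (y + t *: (z - y)).
have seg t : 0 <= t <= 1 -> `|y + t *: (z - y) - x| < r.
  by move=> t01; exact: segment_in_ball.
have := @mean_value R V g 0 1 (fun t => sdiff f (y + t *: (z - y)) (z - y))
  (sdiff f y (z - y)) (e * `|z - y|) ler01 _.
rewrite subr0 scale1r mulr1 /g scale1r scale0r addr0 [y + _]addrC subrK; apply.
move=> t t01; have [d1 d2] := H _ (seg t t01).
have [d3 d4] := H _ yr.
split; first by apply: (has_deriv_comp (has_deriv_line _ _ _)).
rewrite (_ : sdiff f _ _ - sdiff f _ _ = (sdiff f (y + t *: (z - y)) (z - y) - sdiff f x (z - y)) -
  (sdiff f y (z - y) - sdiff f x (z - y))); last by rewrite opprB addrA subrK.
rewrite (le_trans (ler_normB _ _)) // [e in leRHS](splitr e) mulrDl lerD //.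
Qed.

Lemma approx_differentiable V W (f : V -> W) x (L : {linear V -> W}) :
  continuous L ->
  (forall e, 0 < e -> \forall y \near x, `|f y - f x - L (y - x)| <= e * `|y - x|) ->
  differentiable f x /\ sdiff f x = L.
Proof.
move=> cL H.
have E : f \o shift x = cst (f x) + L +o_ 0 id.
  apply/eqaddoP => e e0; rewrite /= !near_simpl.
  have := H e e0; rewrite (near_shift 0 x); apply: filterS => y /=.
  rewrite subr0 addrK -[(_ - _ : V -> W) y]/(_ y - _ y) /=.
  by rewrite opprD addrA.
have dE := diff_unique cL E.
by split; [apply/diff_locallyP; rewrite dE|rewrite sdiff_funE].
Qed.

Lemma near_eq_differentiable V W (f g : V -> W) x :
  (\forall y \near x, f y = g y) -> differentiable f x -> 
  differentiable g x /\ sdiff g x = sdiff f x.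
Proof.
move=> fg df; rewrite (sdiff_funE f); apply: approx_differentiable; first exact: diff_continuous.
move=> e e0; rewrite -(nbhs_singleton fg).
by move: fg (differentiable_approx df e0); apply: filterS2 => y ->; rewrite sdiff_funE.
Qed.

Lemma has_derivB V (f g : R -> V) t a b :
  has_deriv f t a -> has_deriv g t b -> has_deriv (fun s => f s - g s) t (a - b).
Proof.
move=> fa gb e e0; have e2 : 0 < e / 2 by rewrite divr_gt0.
move: (fa _ e2) (gb _ e2); apply: filterS2 => s H1 H2.
rewrite (_ : _ - _ = (f s - f t - (s - t) *: a) - (g s - g t - (s - t) *: b)).
  by rewrite (le_trans (ler_normB _ _)) // [e in leRHS](splitr e) mulrDl lerD.
lmodule R.
Qed.

(** The mixed second difference is the increment over [[0, 1]] of
    [t |-> f (x + h v + t h w) - f (x + t h w)], whose derivative is [h] times an increment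
    of [y |-> 'd f y w], known up to [o(h)] by its differentiability at [x]. *)
Let schwarz_half V W (f : V -> W) x v w :
  (\forall y \near x, differentiable f y) ->
  differentiable (fun y => sdiff f y w) x ->
  forall e, 0 < e -> exists2 r, 0 < r & forall h, 0 < h < r ->
   `|f (x + h *: v + h *: w) - f (x + h *: w) - (f (x + h *: v) - f x) -
     (h * h) *: sdiff (fun y => sdiff f y w) x v| <= e * (h * h).
Proof.
move=> df dg e e0; set g := fun y => sdiff f y w in dg *.
pose K := `|v| + `|w| + 1; have K0 : 0 < K by rewrite ltr_wpDl // addr_ge0.
have e1 : 0 < e / (2 * K) by rewrite divr_gt0 // mulr_gt0.
have [r r0 H] := iffLR (near_distP _ _) (filterI df (differentiable_approx dg e1)).
exists (r / K); first by rewrite divr_gt0.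
move=> h /andP[h0 hr].
have hK : h * K < r by rewrite -ltr_pdivlMr.
have small s t : 0 <= s <= 1 -> 0 <= t <= 1 -> `|s *: (h *: v) + t *: (h *: w)| <= h * (`|v| + `|w|).
  move=> /andP[s0 s1] /andP[t0 t1]; rewrite (le_trans (ler_normD _ _)) //.
  rewrite !normrZ !ger0_norm ?(ltW h0) // mulrDr.
  by rewrite lerD // ler_piMl // mulr_ge0 // ltW.
have small' z : `|z| <= h * (`|v| + `|w|) -> `|x + z - x| < r.
  move=> zh; rewrite addrAC subrr add0r (le_lt_trans zh) // (le_lt_trans _ hK) //.
  by rewrite ler_pM2l // lerDl.
pose ph (t : R) := f (x + h *: v + t *: (h *: w)) - f (x + t *: (h *: w)).
have := @mean_value R W ph 0 1
  (fun t => sdiff f (x + h *: v + t *: (h *: w)) (h *: w) -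
            sdiff f (x + t *: (h *: w)) (h *: w))
  ((h * h) *: sdiff g x v) (e * (h * h)) ler01 _.
rewrite subr0 mulr1 /ph !scale1r !scale0r !addr0; apply.
move=> t t01.
have s1 : `|h *: v + t *: (h *: w)| <= h * (`|v| + `|w|).
  by rewrite -[h *: v]scale1r small // ler01 lexx.
have s0 : `|t *: (h *: w)| <= h * (`|v| + `|w|).
  by rewrite -[t *: _]add0r -[0](scale0r (h *: v)) small // lexx ler01.
have [d1 d1'] := H _ (small' _ s1); have [d0 d0'] := H _ (small' _ s0).
split.
  apply: has_derivB; last by apply: (has_deriv_comp (has_deriv_line _ _ _)).
  by apply: (has_deriv_comp (has_deriv_line _ _ _)); rewrite /= -addrA.
rewrite !sdiffZ -scalerBr -scalerA -scalerBr normrZ gtr0_norm //.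
rewrite mulrCA ler_pM2l //.
have -> : sdiff f (x + h *: v + t *: (h *: w)) w = g (x + (h *: v + t *: (h *: w))).
  by rewrite addrA.
rewrite -/(g (x + t *: (h *: w))).
rewrite [x + _ - x]addrAC subrr add0r in d1'.
rewrite [x + _ - x]addrAC subrr add0r in d0'.
rewrite (_ : _ - _ - _ = (g (x + (h *: v + t *: (h *: w))) - g x - sdiff g x (h *: v + t *: (h *: w)))
   - (g (x + t *: (h *: w)) - g x - sdiff g x (t *: (h *: w)))); last first.
  rewrite sdiffD !sdiffZ; lmodule R.
rewrite (le_trans (ler_normB _ _)) // (le_trans (lerD d1' d0')) //.
rewrite -mulrDr (le_trans (ler_wpM2l (ltW e1) (lerD s1 s0))) //.
rewrite [leLHS](_ : _ = e * h * ((`|v| + `|w|) / K)); last by field; lra.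
by rewrite mulrC ler_piMl ?mulr_ge0 ?(ltW e0) ?(ltW h0) // ler_pdivrMr // mul1r lerDl.
Qed.

(** The mixed second difference is symmetric in [v] and [w]. *)
Lemma schwarz V W (f : V -> W) x v w :
  (\forall y \near x, differentiable f y) ->
  differentiable (fun y => sdiff f y v) x ->
  differentiable (fun y => sdiff f y w) x ->
  sdiff (fun y => sdiff f y w) x v = sdiff (fun y => sdiff f y v) x w.
Proof.
move=> df dv dw; apply/eqP; rewrite -subr_eq0 -normr_le0; apply/ler_addgt0Pr => e e0.
rewrite add0r; have e2 : 0 < e / 2 by rewrite divr_gt0.
have [r1 r10 H1] := schwarz_half v df dw e2.
have [r2 r20 H2] := schwarz_half w df dv e2.
pose h := Num.min r1 r2 / 2.
have h0 : 0 < h by rewrite divr_gt0 // lt_min r10.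
have hr : h < Num.min r1 r2 by rewrite ltr_pdivrMr // ltr_pMr ?ltr1n // lt_min r10.
have {}H1 := H1 h ltac:(by rewrite h0 (lt_le_trans hr) // ge_min lexx).
have {}H2 := H2 h ltac:(by rewrite h0 (lt_le_trans hr) // ge_min lexx orbT).
have hh : 0 < h * h by rewrite mulr_gt0.
rewrite -(ler_pM2l hh) -[X in X * `|_|]gtr0_norm // -normrZ.
set A := f (x + h *: v + h *: w) in H1.
rewrite (_ : f (x + h *: w + h *: v) = A) in H2; last by rewrite addrAC.
set D1 := sdiff _ x v in H1 *; set D2 := sdiff _ x w in H2 *.
rewrite (_ : _ *: _ = (A - f (x + h *: v) - (f (x + h *: w) - f x) - (h * h) *: D2)
  - (A - f (x + h *: w) - (f (x + h *: v) - f x) - (h * h) *: D1)); last by lmodule R.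
by rewrite (le_trans (ler_normB _ _)) //; move: (lerD H2 H1); lra.
Qed.

Lemma near_eq_has_deriv V (f g : R -> V) t d :
  (\forall s \near t, f s = g s) -> has_deriv f t d -> has_deriv g t d.
Proof.
move=> fg fd e e0; rewrite -(nbhs_singleton fg).
by move: fg (fd e e0); apply: filterS2 => s ->.
Qed.

Lemma has_deriv_diff V W (f : V -> W) x v :
  differentiable f x -> has_deriv (fun t : R => f (x + t *: v)) 0 (sdiff f x v).
Proof.
move=> df.
have := @has_deriv_comp R V W f (fun s => x + s *: v) 0 v (has_deriv_line _ _ _).
by rewrite scale0r addr0; apply.
Qed.

Lemma near_line V (x v : V) (P : V -> Prop) :
  (\forall y \near x, P y) -> \forall t \near (0 : R), P (x + t *: v).
Proof.
move=> xP; have := has_deriv_cvg (@has_deriv_line V x v 0).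
by rewrite /= scale0r addr0; apply.
Qed.

(** Differentiating [G' (psi y) = 'd psi y (G y)] along the line through [x] in the
    direction [v]: a product rule in which the factor [y |-> 'd psi y] is only known
    to be differentiable when applied to the fixed vector [G x], and continuous
    in operator norm. *)
Lemma deriv_pushforward n V (psi : 'rV[R]_n -> V) (G : 'rV[R]_n -> 'rV[R]_n)
    (G' : V -> V) x v :
  (\forall y \near x, differentiable psi y) ->
  (forall i, {for x, continuous (fun y => 'D_(delta_mx 0 i) psi y)}) ->
  differentiable (fun y => sdiff psi y (G x)) x ->
  (\forall y \near x, G' (psi y) = sdiff psi y (G y)) ->
  differentiable G x -> differentiable G' (psi x) ->
  sdiff G' (psi x) (sdiff psi x v) =
    sdiff (fun y => sdiff psi y (G x)) x v + sdiff psi x (sdiff G x v).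
Proof.
move=> dpsi cpsi dA G'E dG dG'.
have dx := nbhs_singleton dpsi.
apply: (@has_deriv_unique R V (fun t => G' (psi (x + t *: v))) 0).
  have := has_deriv_comp (f := G') (has_deriv_diff v dx).
  by rewrite scale0r addr0; apply.
apply: (@near_eq_has_deriv V (fun t => sdiff psi (x + t *: v) (G (x + t *: v)))).
  by move: (near_line v G'E); apply: filterS => t ->.
move=> e e0.
have [k k0 kpsi] := diff_bound dx.
have gl := has_deriv_lip (has_deriv_diff v dG) (C := `|sdiff G x v| + 1) ltac:(by rewrite ltrDl).
set C := `|sdiff G x v| + 1 in gl; have C0 : 0 < C by rewrite ltr_wpDl.
have e1 : 0 < e / 3 by rewrite divr_gt0.
have e2 : 0 < e / 3 / k by rewrite divr_gt0.
have e3 : 0 < e / 3 / C by rewrite divr_gt0.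
have E1 := has_deriv_diff v dA e1.
have E2 := has_deriv_diff v dG e2.
have E3 := near_line v (diff_near_cont dpsi cpsi e3).
apply: filterS (filterI (filterI E1 E2) (filterI gl E3)) => t [] [].
rewrite !scale0r !addr0 !subr0 => H1 H2 [H3 H4].
set y := x + t *: v in H1 H2 H3 H4 *.
rewrite (_ : _ - _ = (sdiff psi y (G x) - sdiff psi x (G x) - t *: sdiff (fun y => sdiff psi y (G x)) x v)
  + sdiff psi x (G y - G x - t *: sdiff G x v)
  + (sdiff psi y (G y - G x) - sdiff psi x (G y - G x))); last first.
  rewrite (sdiffB _ _ _ (t *: _)) !sdiffB sdiffZ; lmodule R.
rewrite (le_trans (ler_normD _ _)) // (_ : e = e / 3 + e / 3 + e / 3); last by field.
rewrite 2!mulrDl lerD //.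
  rewrite (le_trans (ler_normD _ _)) // lerD // (le_trans (kpsi _)) //.
  rewrite (le_trans (ler_wpM2l (ltW k0) H2)) // [leLHS](_ : _ = e / 3 * `|t|) //.
  by field; rewrite gt_eqF.
rewrite (le_trans (H4 _)) // (le_trans (ler_wpM2l (ltW e3) H3)) //.
rewrite [leLHS](_ : _ = e / 3 * `|t|) //.
rewrite subr0; by field; rewrite gt_eqF.
Qed.

(** The second derivatives of [psi] cancel by symmetry. *)
Lemma bracket_pushforward n V (psi : 'rV[R]_n -> V) (F G : 'rV[R]_n -> 'rV[R]_n)
    (F' G' : V -> V) x :
  (\forall y \near x, differentiable psi y) ->
  (forall i, {for x, continuous (fun y => 'D_(delta_mx 0 i) psi y)}) ->
  (forall i, differentiable (fun y => 'D_(delta_mx 0 i) psi y) x) ->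
  (\forall y \near x, F' (psi y) = sdiff psi y (F y)) ->
  (\forall y \near x, G' (psi y) = sdiff psi y (G y)) ->
  differentiable F x -> differentiable G x ->
  differentiable F' (psi x) -> differentiable G' (psi x) ->
  sdiff G' (psi x) (F' (psi x)) - sdiff F' (psi x) (G' (psi x)) =
    sdiff psi x (sdiff G x (F x) - sdiff F x (G x)).
Proof.
move=> dpsi cpsi d2psi F'E G'E dF dG dF' dG'.
(* Near [x], ['d psi y w] is a combination of the partial derivatives of [psi]. *)
have dw w : differentiable (fun y => sdiff psi y w) x.
  apply: (proj1 (@near_eq_differentiable _ _
    (\sum_i (fun y => w 0 i *: 'D_(delta_mx 0 i) psi y)) _ _ _ _)).
    move: dpsi; apply: filterS => y dy.
    rewrite fct_sumE (diff_coordE _ _ w); apply: eq_bigr => i _.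
    by rewrite derive_sdiff.
  by apply: differentiable_sum => i; apply: differentiableZ.
rewrite (nbhs_singleton F'E) (nbhs_singleton G'E).
rewrite (deriv_pushforward _ dpsi cpsi (dw _) F'E) //.
rewrite (deriv_pushforward _ dpsi cpsi (dw _) G'E) //.
rewrite (schwarz dpsi (dw (F x)) (dw (G x))) sdiffB; lmodule R.
Qed.

End Calculus.

(** * Frames of C^1 vector fields in coordinates *)
Section Frames.
Context {R : realType} {N : nat}.
Implicit Type F : 'I_N -> 'rV[R]_N -> 'rV[R]_N.

Definition frame_comb F (a x : 'rV[R]_N) : 'rV[R]_N := \sum_i a 0 i *: F i x.

Definition frame_mx F x : 'M[R]_N := \matrix_k F k x.

Definition frame_coord F x (y : 'rV[R]_N) : 'rV[R]_N := y *m invmx (frame_mx F x).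

Definition bracket F k i x : 'rV[R]_N := sdiff (F i) x (F k x) - sdiff (F k) x (F i x).

Lemma frame_combE F a x : frame_comb F a x = a *m frame_mx F x.
Proof.
rewrite /frame_comb mulmx_sum_row; apply: eq_bigr => i _; congr (_ *: _).
by apply/rowP => j; rewrite !mxE.
Qed.

Lemma frame_combB F a b x : frame_comb F (a - b) x = frame_comb F a x - frame_comb F b x.
Proof. by rewrite !frame_combE mulmxBl. Qed.

Lemma frame_combZ F k a x : frame_comb F (k *: a) x = k *: frame_comb F a x.
Proof. by rewrite !frame_combE scalemxAl. Qed.

(** A ball on which the fields [F k] form a frame with uniform constants: [S] bounds
    the fields, [L] their differentials and Lipschitz constants, [K] the passage
    from a vector to its coordinates, and differentiability is uniform. *)
Record frame_ball F (x0 : 'rV[R]_N) (rho S L K : R) : Prop := FrameBall {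
  fb_rho : 0 < rho; fb_S : 0 < S; fb_L : 0 < L; fb_K : 0 < K;
  fb_diff : forall k x, `|x - x0| <= rho -> differentiable (F k) x;
  fb_bound : forall k x, `|x - x0| <= rho -> `|F k x| <= S;
  fb_dbound : forall k x w, `|x - x0| <= rho -> `|sdiff (F k) x w| <= L * `|w|;
  fb_lip : forall k x y, `|x - x0| <= rho -> `|y - x0| <= rho ->
    `|F k y - F k x| <= L * `|y - x|;
  fb_frame : forall z x, `|x - x0| <= rho -> `|z| <= K * `|frame_comb F z x|;
  fb_strict : forall e, 0 < e -> exists2 nu, 0 < nu & forall k x y,
    `|x - x0| <= rho -> `|y - x0| <= rho -> `|y - x| < nu ->
    `|F k y - F k x - sdiff (F k) x (y - x)| <= e * `|y - x| }.

Lemma frame_ball_sub F x0 rho S L K rho' : frame_ball F x0 rho S L K ->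
  0 < rho' <= rho -> frame_ball F x0 rho' S L K.
Proof.
case=> r0 S0 L0 K0 h1 h2 h3 h4 h5 h6 /andP[r'0 rr].
have le x : `|x - x0| <= rho' -> `|x - x0| <= rho by move/le_trans; apply.
split => //.
- by move=> k x /le; apply: h1.
- by move=> k x /le; apply: h2.
- by move=> k x w /le; apply: h3.
- by move=> k x y /le ? /le; apply: h4.
- by move=> z x /le; apply: h5.
- by move=> e /h6[nu nu0 H]; exists nu => // k x y /le ? /le; apply: H.
Qed.

(** The sum of finitely many positive bounds is a common bound. *)
Lemma uniform_pos (P : 'I_N -> R -> Prop) :
  (forall k, exists2 l, 0 < l & P k l) -> (forall k l l', l <= l' -> P k l -> P k l') ->
  exists2 l, 0 < l & forall k, P k l.
Proof.
move=> H mono.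
have [l Hl] : {l : 'I_N -> R & forall k, 0 < l k /\ P k (l k)}.
  by apply: (@choice _ _ (fun k l => 0 < l /\ P k l)) => k; have [l] := H k; exists l.
exists (1 + \sum_k l k); first by rewrite ltr_pwDl // sumr_ge0 // => k _; apply/ltW/(Hl k).1.
move=> k; apply: (mono _ _ _ _ (Hl k).2); rewrite (bigD1 k) //= addrCA lerDl addr_ge0 //.
by rewrite sumr_ge0 // => j _; apply/ltW/(Hl j).1.
Qed.

Lemma uniform_small (P : 'I_N -> R -> Prop) :
  (forall k, exists2 r, 0 < r & P k r) ->
  (forall k r r', 0 < r' <= r -> P k r -> P k r') ->
  exists2 r, 0 < r & forall k, P k r.
Proof.
move=> H mono.
have [l l0 Hl] : exists2 l, 0 < l & forall k, forall r, 0 < r -> r^-1 >= l -> P k r.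
  apply: uniform_pos.
    move=> k; have [r r0 Hr] := H k; exists r^-1; first by rewrite invr_gt0.
    by move=> r' r'0 rr'; apply: (mono _ _ _ _ Hr); rewrite r'0 -lef_pV2 ?posrE.
  by move=> k l l' ll Hl r r0 rl; apply: Hl => //; exact: le_trans rl.
by exists l^-1; [rewrite invr_gt0|move=> k; apply: Hl; rewrite ?invr_gt0 ?invrK].
Qed.

Lemma closed_ball_rV_compact (x0 : 'rV[R]_N) (rho : R) : compact [set x | `|x - x0| <= rho].
Proof.
apply: bounded_closed_compact.
  exists (`|x0| + rho); split; first exact: num_real.
  move=> M HM x /= xr; rewrite -[x](subrK x0) (le_trans (ler_normD _ _)) //; lra.
rewrite (_ : [set _ | _] = closed_ball_ Num.norm x0 rho); last first.
  by apply/funext => x; rewrite /closed_ball_ /= distrC.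
exact: closed_closed_ball_.
Qed.

(** The lower bound on the frame at [x0] survives as long as the fields move by
    less than half of it; uniform differentiability on the closed ball follows
    from strict differentiability at each point by compactness. *)
Lemma frame_ball_exists F x0 (K0 : R) :
  (forall k, \forall x \near x0, (\forall y \near x, differentiable (F k) y) /\
     (forall i, {for x, continuous (fun y => 'D_(delta_mx 0 i) (F k) y)})) ->
  0 < K0 -> (forall z, `|z| <= K0 * `|frame_comb F z x0|) ->
  exists S L K rho, frame_ball F x0 rho S L K.
Proof.
move=> C1 K00 fr.
pose C1at k x := (\forall y \near x, differentiable (F k) y) /\
     (forall i, {for x, continuous (fun y => 'D_(delta_mx 0 i) (F k) y)}).
have {}C1 : \forall x \near x0, forall k, C1at k x.
  exact: (@filter_forall _ _ (fun k x => C1at k x) (nbhs x0)).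
have C10 := nbhs_singleton C1.
have [L1 L10 HL1] : exists2 l, 0 < l & forall k w, `|sdiff (F k) x0 w| <= l * `|w|.
  apply: (@uniform_pos (fun k l => forall w, `|sdiff (F k) x0 w| <= l * `|w|)).
    by move=> k; apply: diff_bound; exact: nbhs_singleton (C10 k).1.
  by move=> k l l' ll H w; rewrite (le_trans (H w)) // ler_wpM2r.
have [S1 S10 HS1] : exists2 s, 0 < s & forall k, `|F k x0| <= s.
  apply: (@uniform_pos (fun k l => `|F k x0| <= l)).
    by move=> k; exists (`|F k x0| + 1); rewrite ?ltr_wpDl ?lerDl.
  by move=> k l l' ll H; rewrite (le_trans H).
have C1d : \forall x \near x0, forall k w, `|sdiff (F k) x w - sdiff (F k) x0 w| <= 1 * `|w|.
  apply: (@filter_forall _ _ (fun k x => forall w, `|sdiff (F k) x w - sdiff (F k) x0 w| <= 1 * `|w|)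
    (nbhs x0)) => k; exact: (diff_near_cont (C10 k).1 (C10 k).2 ltr01).
have [r1 r10 Hr1] := iffLR (near_distP _ _) (filterI C1 C1d).
pose L := L1 + 2.
have L0 : 0 < L by rewrite /L; lra.
have [r2 r20 Hr2] : exists2 r, 0 < r & forall k y z, `|y - x0| < r -> `|z - x0| < r ->
    `|F k z - F k y - sdiff (F k) y (z - y)| <= 1 * `|z - y|.
  apply: (@uniform_small (fun k r => forall y z, `|y - x0| < r -> `|z - x0| < r ->
    `|F k z - F k y - sdiff (F k) y (z - y)| <= 1 * `|z - y|)).
    by move=> k; exact: (strict_diff (C10 k).1 (C10 k).2 ltr01).
  move=> k r r' /andP[_ rr] H y z yr zr.
  by apply: H; [exact: lt_le_trans yr _|exact: lt_le_trans zr _].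
pose r3 := (L * K0 * 2 * N.+1%:R)^-1.
have r30 : 0 < r3 by rewrite invr_gt0 !mulr_gt0.
pose rho := Num.min (Num.min (r1 / 2) (r2 / 2)) (Num.min r3 1).
have rho0 : 0 < rho by rewrite !lt_min !divr_gt0 ?r30 ?ltr01.
have in1 x : `|x - x0| <= rho -> `|x - x0| < r1.
  by move/le_lt_trans; apply; rewrite !gt_min ltr_pdivrMr // ltr_pMr // ltr1n.
have in2 x : `|x - x0| <= rho -> `|x - x0| < r2.
  by move/le_lt_trans; apply; rewrite !gt_min orbA orbC !ltr_pdivrMr // !ltr_pMr // !ltr1n !orbT.
have in3 x : `|x - x0| <= rho -> `|x - x0| <= r3.
  by move/le_trans; apply; rewrite !ge_min lexx !orbT.
have in4 x : `|x - x0| <= rho -> `|x - x0| <= 1.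
  by move/le_trans; apply; rewrite !ge_min lexx !orbT.
have D k x : `|x - x0| <= rho -> differentiable (F k) x.
  by move=> /in1/Hr1[/(_ k)[/nbhs_singleton]].
have dle k x w : `|x - x0| <= rho -> `|sdiff (F k) x w| <= (L1 + 1) * `|w|.
  move=> /in1/Hr1[_ /(_ k w) H]; rewrite -[sdiff _ _ _](subrK (sdiff (F k) x0 w)).
  by rewrite (le_trans (ler_normD _ _)) // addrC mulrDl lerD.
have lip k x y : `|x - x0| <= rho -> `|y - x0| <= rho -> `|F k y - F k x| <= L * `|y - x|.
  move=> xr yr; have H := Hr2 k x y (in2 _ xr) (in2 _ yr).
  rewrite -[F k y - F k x](subrK (sdiff (F k) x (y - x))) (le_trans (ler_normD _ _)) //.
  by rewrite (le_trans (lerD H (dle k x _ xr))) // -mulrDl ler_wpM2r //; rewrite /L; lra.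
have x0r : `|x0 - x0| <= rho by rewrite subrr normr0 ltW.
exists (S1 + L), L, (2 * K0), rho; split => //.
- by rewrite addr_gt0.
- by rewrite mulr_gt0.
- move=> k x xr; rewrite -[F k x](subrK (F k x0)) (le_trans (ler_normD _ _)) //.
  rewrite addrC lerD // (le_trans (lip _ _ _ x0r xr)) //.
  by rewrite ler_piMr ?in4 // ltW.
- by move=> k x w xr; rewrite (le_trans (dle _ _ _ xr)) // ler_wpM2r //; rewrite /L; lra.
- move=> z x xr.
  have H1 : `|frame_comb F z x - frame_comb F z x0| <= N%:R * (L * r3) * `|z|.
    rewrite /frame_comb -sumrB; under eq_bigr do rewrite -scalerBr.
    apply: norm_sumZ_le => i; rewrite (le_trans (lip _ _ _ x0r xr)) //.
    by rewrite ler_wpM2l ?in3 // ltW.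
  have H2 : `|frame_comb F z x0| <= `|frame_comb F z x| + N%:R * (L * r3) * `|z|.
    rewrite -[frame_comb F z x0](subrK (frame_comb F z x)) addrC (le_trans (ler_normD _ _)) //.
    by rewrite lerD // distrC.
  have H3 : N%:R * (L * r3) * `|z| <= `|z| / (2 * K0).
    rewrite [leLHS](_ : _ = N%:R / N.+1%:R * (`|z| / (2 * K0))).
      rewrite ler_piMl // ?divr_ge0 // ?mulr_ge0 // ?(ltW K00) //.
      by rewrite ler_pdivrMr // mul1r ler_nat.
    rewrite /r3; field; rewrite !gt_eqF //; apply/and3P; split => //.
  have H4 := fr z.
  have H5 : `|z| <= K0 * (`|frame_comb F z x| + `|z| / (2 * K0)).
    by rewrite (le_trans H4) // ler_wpM2l ?(ltW K00) // (le_trans H2) // lerD2l.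
  move: H5; rewrite mulrDr (_ : K0 * (`|z| / (2 * K0)) = `|z| / 2); first lra.
  by field; rewrite gt_eqF.
- move=> e e0.
  pose P nu k x := forall y, `|x - x0| <= rho -> `|y - x0| <= rho -> `|y - x| < nu ->
    `|F k y - F k x - sdiff (F k) x (y - x)| <= e * `|y - x|.
  have [nu nu0 H] : exists2 nu, 0 < nu & forall k x, `|x - x0| <= rho -> P nu k x.
    apply: (@uniform_small (fun k nu => forall x, `|x - x0| <= rho -> P nu k x)); last first.
      move=> k r r' /andP[_ rr] H x xr y xr' yr xy; apply: (H x xr) => //.
      exact: lt_le_trans xy _.
    move=> k.
    have /compact_near_coveringP cpt := @closed_ball_rV_compact x0 rho.
    have {}cpt : \forall nu \near (0 : R)^'+,
        [set x | `|x - x0| <= rho] `<=` (fun x => P nu k x).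
      apply: cpt => x xr.
      have [c1 c2] := (Hr1 _ (in1 _ xr)).1 k.
      have [r r0 H] := strict_diff c1 c2 e0.
      have r20' : 0 < r / 2 by rewrite divr_gt0.
      exists ([set x' | `|x' - x| < r / 2], [set nu | nu < r / 2]).
        split; last exact: nbhs_right_lt.
        exact (near_dist x r20').
      move=> [x' nu] [/= xx' nur] y _ _ x'y.
      apply: H; first by rewrite (lt_le_trans xx') // ler_pdivrMr // ler_pMr // ler1n.
      rewrite -[y](subrK x') -addrA (le_lt_trans (ler_normD _ _)) // [r]splitr ltrD //.
      exact: lt_trans nur.
    have [nu [nu0 H]] := filter_ex (filterI (nbhs_right_gt (0 : R)) cpt).
    by exists nu => // x xr; exact: H.
  exists nu => // k x y xr yr xy; exact: (H k x xr).
Qed.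

Section InBall.
Context F x0 rho S L K (FB : frame_ball F x0 rho S L K).
Let n : R := N%:R.
Let B x := `|x - x0| <= rho.

Lemma frame_unit x : B x -> frame_mx F x \in unitmx.
Proof.
move=> Bx; rewrite -row_free_unit -kermx_eq0; apply/eqP/row_matrixP => i.
rewrite row0; apply/eqP; rewrite -normr_le0.
rewrite (le_trans (fb_frame FB _ Bx)) // frame_combE -row_mul mulmx_ker row0 normr0 mulr0 //.
Qed.

Lemma frame_coordK x y : B x -> frame_comb F (frame_coord F x y) x = y.
Proof. by move=> Bx; rewrite frame_combE mulmxKV // frame_unit. Qed.

Lemma frame_combK x z : B x -> frame_coord F x (frame_comb F z x) = z.
Proof. by move=> Bx; rewrite frame_combE /frame_coord mulmxK // frame_unit. Qed.

Lemma frame_coord_le x y : B x -> `|frame_coord F x y| <= K * `|y|.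
Proof. by move=> Bx; rewrite -{2}(frame_coordK y Bx) (fb_frame FB). Qed.

Lemma frame_comb_le a x : B x -> `|frame_comb F a x| <= n * S * `|a|.
Proof. by move=> Bx; apply: norm_sumZ_le => i; apply: (fb_bound FB). Qed.

Lemma frame_comb_lip a x y : B x -> B y -> `|frame_comb F a y - frame_comb F a x| <= n * (L * `|y - x|) * `|a|.
Proof.
move=> Bx By; rewrite /frame_comb -sumrB; under eq_bigr do rewrite -scalerBr.
by apply: norm_sumZ_le => i; apply: (fb_lip FB).
Qed.

Lemma frame_comb_diff a x : B x -> differentiable (frame_comb F a) x /\
  forall w, sdiff (frame_comb F a) x w = \sum_i a 0 i *: sdiff (F i) x w.
Proof.
move=> Bx.
have E : frame_comb F a = \sum_i (a 0 i *: F i) by apply/funext => y; rewrite fct_sumE.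
have D i : differentiable (a 0 i *: F i) x.
  by apply: differentiableZ; apply: (fb_diff FB).
have D' : differentiable (frame_comb F a) x by rewrite E; apply: differentiable_sum.
split=> // w; rewrite -derive_sdiff // E derive_sum; last first.
  by move=> i; apply: diff_derivable.
apply: eq_bigr => i _; rewrite deriveZ ?derive_sdiff //; last exact/diff_derivable/(fb_diff FB).
exact: (fb_diff FB).
Qed.

Lemma bracket_le k i x : B x -> `|bracket F k i x| <= 2 * L * S.
Proof.
move=> Bx; rewrite (le_trans (ler_normB _ _)) // -mulrA mulr_natl mulr2n.
by rewrite lerD // (le_trans (fb_dbound FB _ _ Bx)) // ler_wpM2l ?(ltW (fb_L FB)) //
  (fb_bound FB).
Qed.

End InBall.
End Frames.

(** * Two integral curves from the same point *)
Section Curves.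
Context {R : realType} {N : nat}.
Implicit Type F : 'I_N -> 'rV[R]_N -> 'rV[R]_N.

Lemma norm_max (V : normedModType R) (g : R -> V) :
  (forall t : R, 0 <= t <= 1 -> g x @[x --> t] --> g t) ->
  exists2 t : R, 0 <= t <= 1 & forall s : R, 0 <= s <= 1 -> `|g s| <= `|g t|.
Proof.
move=> gc.
have [|t tI H] := @EVT_max R (fun t => `|g t|) 0 1 ler01.
  apply: continuous_in_subspaceT => t; rewrite inE /= in_itv /= => t01.
  exact (cvg_norm (gc t t01)).
by exists t; [rewrite in_itv in tI|move=> s s01; apply: H; rewrite in_itv].
Qed.

Section InBall.
Context F x0 rho S L K (FB : @frame_ball R N F x0 rho S L K).
Let n : R := N%:R.
Let B x := `|x - x0| <= rho.
Let S0 : 0 < S := fb_S FB.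
Let L0 : 0 < L := fb_L FB.
Let K0 : 0 < K := fb_K FB.
Let n0 : 0 <= n. Proof. exact: ler0n. Qed.

(** At a point where the distance [|D|] is maximal, the Lipschitz part of the
    equation contributes at most half of it, which is absorbed on the left; this
    replaces Gronwall's lemma for small coefficients. *)
Lemma curves_close c c' (f f' : R -> 'rV[R]_N) :
  n * L * `|c| <= 1 / 2 ->
  (forall t : R, 0 <= t <= 1 -> B (f t) /\ has_deriv f t (frame_comb F c (f t))) ->
  (forall t : R, 0 <= t <= 1 -> B (f' t) /\ has_deriv f' t (frame_comb F c' (f' t))) ->
  forall t : R, 0 <= t <= 1 ->
    `|f' t - f t| <= 2 * (`|f' 0 - f 0| + n * S * `|c' - c|).
Proof.
move=> cs Hf Hf'.
pose D t := f' t - f t.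
have deltaD t : 0 <= t <= 1 -> has_deriv D t (frame_comb F c' (f' t) - frame_comb F c (f t)).
  by move=> t01; apply: has_derivB; [exact: (Hf' t t01).2|exact: (Hf t t01).2].
have [|t t01 Ht] := @norm_max _ D.
  by move=> t /deltaD /has_deriv_cvg.
have := @mean_value R _ D 0 t (fun t => frame_comb F c' (f' t) - frame_comb F c (f t)) 0
  (n * S * `|c' - c| + 1 / 2 * `|D t|) (proj1 (andP t01)) _.
rewrite scaler0 subr0 subr0 => H.
have {}H : `|D t - D 0| <= (n * S * `|c' - c| + 1 / 2 * `|D t|) * t.
  apply: H => s /andP[s0 st]; have s01 : 0 <= s <= 1.
    by rewrite s0 (le_trans st) //; case/andP: t01.
  split; first exact: deltaD.
  have [Bs _] := Hf s s01; have [Bs' _] := Hf' s s01.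
  rewrite subr0 (_ : _ - _ = frame_comb F (c' - c) (f' s) + (frame_comb F c (f' s) - frame_comb F c (f s))); last first.
    by rewrite frame_combB addrA subrK.
  rewrite (le_trans (ler_normD _ _)) // lerD ?(frame_comb_le FB) //.
  rewrite (le_trans (frame_comb_lip FB _ Bs Bs')) // [leLHS](_ : _ = n * L * `|c| * `|D s|).
    by rewrite ler_pM // ?Ht // !mulr_ge0 // ltW.
  by rewrite /D; ring.
have {}H : `|D t| <= `|D 0| + (n * S * `|c' - c| + 1 / 2 * `|D t|).
  rewrite -[D t in leLHS](subrK (D 0)) [X in `|X|]addrC (le_trans (ler_normD _ _)) //.
  rewrite lerD2l (le_trans H) //.
  have /andP[_ t1] := t01; rewrite ler_piMr // addr_ge0 // ?mulr_ge0 // ltW //.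
move=> s s01; rewrite (le_trans (Ht s s01)) //; rewrite -/(D 0); lra.
Qed.

(** With [z = frame_coord (f t) (D t)] frozen, [D s - frame_comb F z (f s)] vanishes
    at [t]; its derivative there is the derivative of the coordinates, read in
    the frame, and the lower bound of the frame carries the error estimate over
    to the coordinates. *)
Lemma frame_coord_has_deriv (f D : R -> 'rV[R]_N) t df deltaD :
  `|f t - x0| < rho -> has_deriv f t df -> has_deriv D t deltaD ->
  has_deriv (fun s => frame_coord F (f s) (D s)) t
    (frame_coord F (f t) (deltaD - \sum_k frame_coord F (f t) (D t) 0 k *: sdiff (F k) (f t) df)).
Proof.
move=> ft fd Dd; set z := frame_coord F (f t) (D t); set w := frame_coord F (f t) (_ - _).
have Bt : B (f t) by exact: ltW.
have nB : \forall s \near t, B (f s).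
  have r0 : 0 < rho - `|f t - x0| by rewrite subr_gt0.
  have H : \forall s \near t, `|f s - f t| < rho - `|f t - x0|.
    exact (has_deriv_cvg fd (near_dist (f t) r0)).
  move: H; apply: filterS => s H.
  rewrite /B -[f s](subrK (f t)) -addrA (le_trans (ler_normD _ _)) //; lra.
have [dz dzE] := frame_comb_diff FB z Bt; have [dw _] := frame_comb_diff FB w Bt.
have Pd : has_deriv (fun s => D s - frame_comb F z (f s)) t (frame_comb F w (f t)).
  rewrite (frame_coordK FB) //; apply: has_derivB => //.
  by rewrite -dzE; exact: (has_deriv_comp fd).
have wc := has_deriv_cvg (has_deriv_comp fd dw).
move=> e e0; have e1 : 0 < e / (2 * K) by rewrite divr_gt0 // mulr_gt0.
have wn : \forall s \near t, `|frame_comb F w (f s) - frame_comb F w (f t)| < e / (2 * K).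
  exact (wc _ (near_dist (frame_comb F w (f t)) e1)).
apply: filterS (filterI nB (filterI wn (Pd _ e1))) => s [Bs [H1 H2]].
rewrite (le_trans (fb_frame FB _ Bs)) //.
rewrite frame_combB frame_combB frame_combZ (frame_coordK FB) //.
have E : D t = frame_comb F z (f t) by rewrite (frame_coordK FB).
rewrite E subrr subr0 in H2.
rewrite (_ : _ - _ = (D s - frame_comb F z (f s) - (s - t) *: frame_comb F w (f t)) -
   (s - t) *: (frame_comb F w (f s) - frame_comb F w (f t))); last by rewrite -/z; lmodule R.
rewrite -ler_pdivlMl // (le_trans (ler_normB _ _)) //.
rewrite [leRHS](_ : _ = e / (2 * K) * `|s - t| + `|s - t| * (e / (2 * K))); last by field; rewrite gt_eqF.
apply: lerD; [exact: H2|by rewrite normrZ ler_wpM2l // ltW].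
Qed.

Lemma frame_coordD x y y' : frame_coord F x (y + y') = frame_coord F x y + frame_coord F x y'.
Proof. exact: mulmxDl. Qed.

Lemma frame_coordZ x k y : frame_coord F x (k *: y) = k *: frame_coord F x y.
Proof. by rewrite /frame_coord scalemxAl. Qed.

Lemma frame_coord_sum (I : Type) (r : seq I) x (E : I -> 'rV[R]_N) :
  frame_coord F x (\sum_(i <- r) E i) = \sum_(i <- r) frame_coord F x (E i).
Proof. exact: mulmx_suml. Qed.

(** The brackets appear as the difference between moving the field [c] by the
    variation [z] and moving the frame along the field [c]. *)
Lemma bracket_sum x (z c : 'rV[R]_N) : 
  \sum_k \sum_i (z 0 k * c 0 i) *: bracket F k i x =
  \sum_i c 0 i *: sdiff (F i) x (frame_comb F z x) - \sum_k z 0 k *: sdiff (F k) x (frame_comb F c x).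
Proof.
transitivity (\sum_k \sum_i (z 0 k * c 0 i) *: sdiff (F i) x (F k x) -
    \sum_k \sum_i (z 0 k * c 0 i) *: sdiff (F k) x (F i x)).
  rewrite -sumrB; apply: eq_bigr => k _; rewrite -sumrB; apply: eq_bigr => i _.
  by rewrite /bracket scalerBr.
congr (_ - _).
  rewrite exchange_big /=; apply: eq_bigr => i _; rewrite /frame_comb sdiff_sum scaler_sumr.
  by apply: eq_bigr => k _; rewrite sdiffZ scalerA mulrC.
apply: eq_bigr => k _; rewrite /frame_comb sdiff_sum scaler_sumr.
by apply: eq_bigr => i _; rewrite sdiffZ scalerA.
Qed.

(** The remainder of the equation of variations for a finite variation [v] of the
    coefficients, at corresponding points [x], [x'] of the two curves. *)
Definition variation_error (c v x x' : 'rV[R]_N) : 'rV[R]_N :=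
  \sum_i c 0 i *: (F i x' - F i x - sdiff (F i) x (x' - x)) +
  \sum_i v 0 i *: (F i x' - F i x).

(** The equation of variations for the coordinates of [x' - x] in the frame at [x]:
    the left-hand side is their derivative, by [frame_coord_has_deriv]. *)
Lemma variation_split (c c' x x' : 'rV[R]_N) : B x ->
  let z := frame_coord F x (x' - x) in
  frame_coord F x (frame_comb F c' x' - frame_comb F c x - \sum_k z 0 k *: sdiff (F k) x (frame_comb F c x)) =
  (c' - c) + \sum_k \sum_i (z 0 k * c 0 i) *: frame_coord F x (bracket F k i x) +
  frame_coord F x (variation_error c (c' - c) x x').
Proof.
move=> Bx z.
have -> : \sum_k \sum_i (z 0 k * c 0 i) *: frame_coord F x (bracket F k i x) =
    frame_coord F x (\sum_k \sum_i (z 0 k * c 0 i) *: bracket F k i x).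
  rewrite frame_coord_sum; apply: eq_bigr => k _; rewrite frame_coord_sum.
  by apply: eq_bigr => i _; rewrite frame_coordZ.
rewrite -{1}(frame_combK FB (c' - c) Bx) -!frame_coordD; congr frame_coord.
rewrite bracket_sum (frame_coordK FB) // /variation_error.
have -> : \sum_i c 0 i *: (F i x' - F i x - sdiff (F i) x (x' - x)) =
  frame_comb F c x' - frame_comb F c x - \sum_i c 0 i *: sdiff (F i) x (x' - x).
  by rewrite /frame_comb -!sumrB; apply: eq_bigr => i _; rewrite !scalerBr.
have -> : \sum_i (c' - c) 0 i *: (F i x' - F i x) = frame_comb F (c' - c) x' - frame_comb F (c' - c) x.
  by rewrite /frame_comb -sumrB; apply: eq_bigr => i _; rewrite scalerBr.
rewrite !frame_combB; lmodule R.
Qed.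

Lemma variation_error_le c v x x' e nu : B x -> B x' -> `|x' - x| < nu ->
  (forall k, `|F k x' - F k x - sdiff (F k) x (x' - x)| <= e * `|x' - x|) ->
  `|variation_error c v x x'| <= n * (e * `|c| + L * `|v|) * `|x' - x|.
Proof.
move=> Bx Bx' xx H; rewrite (le_trans (ler_normD _ _)) //.
rewrite [leRHS](_ : _ = n * (e * `|x' - x|) * `|c| + n * (L * `|x' - x|) * `|v|); last by ring.
by apply: lerD; apply: norm_sumZ_le => // i; apply: (fb_lip FB).
Qed.

Section Weighted.
Variables (deg : 'I_N -> nat) (eps : R).
Hypotheses (eps0 : 0 < eps) (eps1 : eps <= 1).

(** The sup norm of [weighted y] is the homogeneous size of [y] at scale [eps]. *)
Definition weighted (y : 'rV[R]_N) : 'rV[R]_N := \row_l (y 0 l / eps ^+ deg l).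

Let M := (\max_l deg l)%N.

Let p0 l : 0 < eps ^+ deg l. Proof. exact: exprn_gt0. Qed.

Let pM l : eps ^+ M <= eps ^+ deg l.
Proof. by apply: ler_wiXn2l; [exact: ltW| |exact: leq_bigmax]. Qed.

Lemma weightedB y y' : weighted (y - y') = weighted y - weighted y'.
Proof. by apply/rowP => l; rewrite !mxE mulrBl. Qed.

Lemma weightedD y y' : weighted (y + y') = weighted y + weighted y'.
Proof. by apply/rowP => l; rewrite !mxE mulrDl. Qed.

Lemma weightedZ k y : weighted (k *: y) = k *: weighted y.
Proof. by apply/rowP => l; rewrite !mxE mulrA. Qed.

Lemma weighted_leP (y : 'rV[R]_N) (m : R) : 0 <= m ->
  (forall l, `|y 0 l| <= m * eps ^+ deg l) <-> `|weighted y| <= m.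
Proof.
move=> m0; split => H.
  by apply: row_norm_le => // l; rewrite mxE normrM normfV (gtr0_norm (p0 l)) ler_pdivrMr.
move=> l; have := le_trans (row_norm_ge (weighted y) l) H.
by rewrite mxE normrM normfV (gtr0_norm (p0 l)) ler_pdivrMr.
Qed.

Lemma weighted_ge y : `|y| <= `|weighted y|.
Proof.
apply: row_norm_le => // l.
have := row_norm_ge (weighted y) l; rewrite mxE normrM normfV (gtr0_norm (p0 l)).
apply: le_trans; rewrite ler_pdivlMr // ler_piMr // exprn_ile1 // ltW //.
Qed.

Lemma weighted_le y : `|weighted y| <= `|y| / eps ^+ M.
Proof.
apply/weighted_leP; first by rewrite divr_ge0 // exprn_ge0 // ltW.
move=> l; rewrite (le_trans (row_norm_ge y l)) // -mulrA ler_peMr //.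
by rewrite mulrC ler_pdivlMr ?exprn_gt0 // mul1r pM.
Qed.

Lemma weighted_ball_compact a m : compact [set y | `|weighted (y - a)| <= m].
Proof.
have em0 : 0 < eps ^+ M by rewrite exprn_gt0.
apply: bounded_closed_compact.
  exists (`|a| + m); split; first exact: num_real.
  move=> k mk y /= ym; rewrite -[y](subrK a) (le_trans (ler_normD _ _)) //.
  have := le_trans (weighted_ge (y - a)) ym; lra.
move=> y yC /=; apply/ler_addgt0Pr => e e0.
have [z [/= zm zy]] := yC _ (near_dist y (mulr_gt0 e0 em0)).
rewrite -[y - a](subrKA z) weightedD (le_trans (ler_normD _ _)) // addrC lerD //.
by rewrite (le_trans (weighted_le _)) // ler_pdivrMr // distrC ltW.
Qed.

Lemma weighted_has_deriv (g : R -> 'rV[R]_N) t d :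
  has_deriv g t d -> has_deriv (weighted \o g) t (weighted d).
Proof.
move=> gd e e0; have e1 : 0 < e * eps ^+ M by rewrite mulr_gt0 // exprn_gt0.
move: (gd _ e1); apply: filterS => s H /=.
rewrite -!weightedB -weightedZ -weightedB (le_trans (weighted_le _)) //.
by rewrite ler_pdivrMr ?exprn_gt0 // mulrAC.
Qed.

Hypothesis deg_bracket : forall x, B x -> forall k i l,
  (deg k + deg i < deg l)%N -> frame_coord F x (bracket F k i x) 0 l = 0.

(** A coordinate [l] of the bracket of [F k] and [F i] is nonzero only if
    [deg l <= deg k + deg i], and then [eps^(deg k) eps^(deg i) <= eps^(deg l)]: the bound
    does not depend on [eps]. *)
Lemma weighted_bracket_le x (z c : 'rV[R]_N) eta : B x -> 0 <= eta ->
  (forall i, `|c 0 i| <= eta * eps ^+ deg i) ->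
  `|weighted (\sum_k \sum_i (z 0 k * c 0 i) *: frame_coord F x (bracket F k i x))| <=
  n * n * (K * (2 * L * S)) * eta * `|weighted z|.
Proof.
move=> Bx eta0 ceta; set Z := `|weighted z|.
have Z0 : 0 <= Z by exact: normr_ge0.
have zZ k : `|z 0 k| <= Z * eps ^+ deg k by apply: (iffRL (weighted_leP z (normr_ge0 _))).
have L2 : 0 <= K * (2 * L * S) by rewrite !mulr_ge0 // ltW.
have H k i l : `|frame_coord F x (bracket F k i x) 0 l| <= K * (2 * L * S).
  rewrite (le_trans (row_norm_ge _ l)) // (le_trans (frame_coord_le FB _ Bx)) //.
  by rewrite ler_wpM2l ?(ltW K0) // (bracket_le FB).
move: (K * (2 * L * S)) L2 H => Lam Lam0 H.
apply/weighted_leP => [|l]; first by rewrite !mulr_ge0.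
rewrite summxE (le_trans (ler_norm_sum _ _ _)) //.
rewrite (le_trans (y := \sum_(k < N) \sum_(i < N) (Lam * eta * Z * eps ^+ deg l))) //.
  apply: ler_sum => k _; rewrite summxE (le_trans (ler_norm_sum _ _ _)) //.
  apply: ler_sum => i _; rewrite mxE.
  have [kil|kil] := ltnP (deg k + deg i) (deg l).
    by rewrite deg_bracket // mulr0 normr0 !mulr_ge0 // ltW.
  rewrite !normrM.
  rewrite (le_trans (y := (Z * eps ^+ deg k * (eta * eps ^+ deg i)) * Lam)) //.
    by rewrite ler_pM // ?mulr_ge0 // ler_pM.
  rewrite [leLHS](_ : _ = Lam * eta * Z * (eps ^+ deg k * eps ^+ deg i)); last by ring.
  rewrite ler_wpM2l ?mulr_ge0 // -exprD ler_wiXn2l //; exact: ltW.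
rewrite !sumr_const !card_ord -[leLHS]mulr_natl -[X in _ * X]mulr_natl.
by rewrite le_eqVlt; apply/orP; left; apply/eqP; rewrite /n; ring.
Qed.

(** Let [Z] be the largest weighted norm of the coordinates [z t] of [f' t - f t], and
    [V] that of [c' - c].  The equation of variations, whose right-hand side is
    [c' - c] up to [(Z + V) / 8], gives [Z <= V + (Z + V) / 8] and
    [V <= |z 1| + (Z + V) / 8], hence [V <= 2 |z 1|].  The constant [nu] depends on [eps],
    as the remainder of the equation is estimated without weights. *)
Lemma coefficients_le eta : 0 < eta -> eta <= 1 -> 2 * n * L * eta <= 1 ->
  8 * (n * n * (K * (2 * L * S)) * eta) <= 1 ->
  exists2 nu, 0 < nu & forall (c c' : 'rV[R]_N) (f f' : R -> 'rV[R]_N) m,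
    (forall i, `|c 0 i| <= eta * eps ^+ deg i) -> `|c' - c| < nu -> f 0 = f' 0 ->
    (forall t : R, 0 <= t <= 1 -> `|f t - x0| < rho /\ has_deriv f t (frame_comb F c (f t))) ->
    (forall t : R, 0 <= t <= 1 -> B (f' t) /\ has_deriv f' t (frame_comb F c' (f' t))) ->
    `|weighted (frame_coord F (f 1) (f' 1 - f 1))| <= m ->
    `|weighted (c' - c)| <= 2 * m.
Proof.
move=> eta0 eta1 nLe nnLe; pose n1 : R := N.+1%:R.
have n10 : 0 < n1 by rewrite ltr0n.
have nn1 : n <= n1 by rewrite ler_nat.
have epsM0 : 0 < eps ^+ M by rewrite exprn_gt0.
(* The remainder has to be below [V / 8] after division by the smallest weight
   [eps ^+ M]; [e] and [nu3] give half of it to each of its two terms, and [nu2]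
   makes the curves close enough for [Hnu1]. *)
pose ka := eps ^+ M / 8; have ka0 : 0 < ka by rewrite divr_gt0.
pose e := ka / (4 * K * S * n1 * n1).
have e0 : 0 < e by rewrite divr_gt0 // !mulr_gt0.
have [nu1 nu10 Hnu1] := fb_strict FB e0.
pose nu2 := nu1 / (2 * S * n1); have nu20 : 0 < nu2 by rewrite divr_gt0 // !mulr_gt0.
pose nu3 := ka / (4 * K * L * S * n1 * n1).
have nu30 : 0 < nu3 by rewrite divr_gt0 // !mulr_gt0.
exists (Num.min nu2 nu3); first by rewrite lt_min nu20.
move=> c c' f f' m ceta; set v := c' - c; rewrite lt_min => /andP[v2 v3] ff0 Hf Hf' Hm.
have c_eta : `|c| <= eta.
  apply: row_norm_le => [|i]; first exact: ltW.
  by rewrite (le_trans (ceta i)) // ler_piMr ?(ltW eta0) // exprn_ile1 // ltW.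
pose D t := f' t - f t.
pose z t := frame_coord F (f t) (D t).
pose w t := frame_coord F (f t) (frame_comb F c' (f' t) - frame_comb F c (f t) -
  \sum_k z t 0 k *: sdiff (F k) (f t) (frame_comb F c (f t))).
have Bf t : 0 <= t <= 1 -> B (f t) by move=> /Hf[/ltW].
have Dle t : 0 <= t <= 1 -> `|D t| <= 2 * n * S * `|v|.
  move=> t01; have := @curves_close c c' f f' _ _ Hf' t t01.
  rewrite ff0 subrr normr0 add0r !mulrA; apply.
    have H : n * L * `|c| <= n * L * eta by rewrite ler_wpM2l ?mulr_ge0 // ltW.
    by rewrite (le_trans H) // ler_pdivlMr // mulrC !mulrA.
  by move=> s s01; split; [exact: Bf|exact: (Hf s s01).2].
have zd t : 0 <= t <= 1 -> has_deriv (weighted \o z) t (weighted (w t)).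
  move=> t01; apply: weighted_has_deriv; apply: frame_coord_has_deriv.
  - exact: (Hf t t01).1.
  - exact: (Hf t t01).2.
  - by apply: has_derivB; [exact: (Hf' t t01).2|exact: (Hf t t01).2].
set V := `|weighted v|.
have vV : `|v| <= V by exact: weighted_ge.
have V0 : 0 <= V by exact: normr_ge0.
have wle t : 0 <= t <= 1 -> `|weighted (w t) - weighted v| <= 1 / 8 * `|weighted (z t)| + 1 / 8 * V.
  move=> t01; have Bt := Bf t t01; have [Bt' _] := Hf' t t01.
  rewrite -weightedB.
  rewrite /w (variation_split c c' _ Bt) -/v; set P := \sum_k _; set E := frame_coord F (f t) _.
  rewrite (_ : v + P + E - v = P + E); last by lmodule R.
  have E0 : `|E| <= ka * V.
    have D2 := Dle t t01.
    have Dnu : `|f' t - f t| < nu1.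
      rewrite (le_lt_trans D2) // (@le_lt_trans _ _ (2 * S * n1 * `|v|)) //.
        by rewrite [leRHS](_ : _ = 2 * n1 * S * `|v|) ?ler_wpM2r ?(ltW S0) ?ler_wpM2l //; ring.
      by rewrite mulrC -ltr_pdivlMr // !mulr_gt0.
    have H k := Hnu1 k (f t) (f' t) Bt Bt' Dnu.
    have H1 := variation_error_le c v Bt Bt' Dnu H.
    rewrite (le_trans (frame_coord_le FB _ Bt)) //.
    have H2 : n * (e * `|c| + L * `|v|) <= n1 * (e + L * nu3).
      apply: ler_pM => //; first by rewrite addr_ge0 // mulr_ge0 // ltW.
      apply: lerD; first by rewrite ler_piMr ?(ltW e0) // (le_trans c_eta).
      by rewrite ler_wpM2l ?(ltW L0) // ltW.
    have H3 : `|f' t - f t| <= 2 * n1 * S * `|v|.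
      by rewrite (le_trans D2) // !ler_wpM2r ?(ltW S0) // ler_wpM2l.
    have H4 : `|variation_error c v (f t) (f' t)| <= n1 * (e + L * nu3) * (2 * n1 * S * `|v|).
      rewrite (le_trans H1) //; apply: ler_pM => //.
      by rewrite mulr_ge0 // addr_ge0 // mulr_ge0 // ltW.
    rewrite (le_trans (ler_wpM2l (ltW K0) H4)) // (@le_trans _ _ (ka * `|v|)) //.
      rewrite le_eqVlt; apply/orP; left; apply/eqP; rewrite /e /nu3.
      by field; rewrite !gt_eqF.
    by rewrite ler_wpM2l // ltW.
  rewrite weightedD (le_trans (ler_normD _ _)) // lerD //.
    rewrite (le_trans (weighted_bracket_le _ Bt (ltW eta0) ceta)) //.
    by rewrite ler_wpM2r // ler_pdivlMr // mulrC.
  rewrite (le_trans (weighted_le _)) // ler_pdivrMr //.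
  by rewrite (le_trans E0) // le_eqVlt; apply/orP; left; apply/eqP; rewrite /ka; field.
have [|t t01 Ht] := @norm_max _ (weighted \o z).
  by move=> t /zd /has_deriv_cvg.
set Z := `|_| in Ht.
have z0 : weighted (z 0) = 0.
  rewrite /z /D ff0 subrr; apply/rowP => l; rewrite mxE /frame_coord mul0mx !mxE mul0r //.
have main s : 0 <= s <= 1 -> `|weighted (z s) - s *: weighted v| <= (1 / 8 * Z + 1 / 8 * V) * s.
  move=> /andP[s0 s1].
  have := @mean_value R _ (weighted \o z) 0 s (fun t => weighted (w t)) (weighted v)
    (1 / 8 * Z + 1 / 8 * V) s0 _.
  rewrite /= z0 !subr0; apply => x /andP[x0' xs].
  have x01 : 0 <= x <= 1 by rewrite x0' (le_trans xs).
  split; first exact: zd.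
  by rewrite (le_trans (wle _ x01)) // lerD2r ler_wpM2l // Ht.
have one01 : ((0 : R) <= 1) && ((1 : R) <= 1) by rewrite ler01 lexx.
have H1 := main 1 one01; rewrite scale1r mulr1 in H1.
have H2 : V <= m + (1 / 8 * Z + 1 / 8 * V).
  rewrite {1}/V -[weighted v](subrK (weighted (z 1))) [X in `|X|]addrC.
  rewrite (le_trans (ler_normD _ _)) //; apply: lerD; first exact: Hm.
  by rewrite distrC.
have H3 : Z <= V + (1 / 8 * Z + 1 / 8 * V).
  have /andP[t0 t1] := t01.
  rewrite {1}/Z /= -[weighted (z t)](subrK (t *: weighted v)) [X in `|X|]addrC.
  rewrite (le_trans (ler_normD _ _)) //; apply: lerD; first by rewrite normrZ ger0_norm // ler_piMl.
  rewrite (le_trans (main t t01)) // ler_piMr // addr_ge0 // mulr_ge0 //.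
  by rewrite /Z.
lra.
Qed.

End Weighted.

End InBall.
End Curves.

(** * Vector fields, brackets and integral curves in a chart *)
Section Charts.
Context {R : realType} {N : nat} (M : smooth_manifold R N).

Lemma chart_nbhs (c : chart M) (p : M) (A : set M) : cdom c p -> nbhs p A ->
  \forall x \near phi c p, [/\ cdom c (psi c x), A (psi c x) & phi c (psi c x) = x].
Proof.
move=> cp pA.
have im : (phi c @` cdom c) (phi c p) by exists p.
have nim : nbhs (phi c p) (phi c @` cdom c) by apply: open_nbhs_nbhs; split => //; exact: open_cimage.
have nA : \forall x \near phi c p, A (psi c x).
  have H : psi c x @[x --> phi c p] --> psi c (phi c p) := psi_continuous im.
  by rewrite phiK // in H; exact: H.
apply: filterS (filterI nim nA) => x [[q cq <-]]; rewrite phiK //.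
Qed.

Lemma near_transition (c d : chart M) (p : M) : cdom c p -> cdom d p ->
  \forall x \near phi c p, (phi c @` (cdom c `&` cdom d)) x.
Proof.
move=> cp dp.
have dn : nbhs p (cdom d) by apply: open_nbhs_nbhs; split => //; exact: open_cdom.
by apply: filterS (chart_nbhs cp dn) => x [cx dx xE]; exists (psi c x).
Qed.

Lemma transition_diff (c d : chart M) (p : M) : cdom c p -> cdom d p ->
  \forall x \near phi c p, differentiable (phi d \o psi c) x.
Proof.
move=> cp dp; apply: filterS (near_transition cp dp) => x.
exact: (proj1 (transition_smooth c d 1)).
Qed.

Lemma transition_C1 (c d : chart M) (p : M) i : cdom c p -> cdom d p ->
  {for phi c p, continuous (fun x => 'D_(delta_mx 0 i) (phi d \o psi c) x)}.
Proof.
by move=> cp dp; apply: (proj2 (transition_smooth c d 1) i); exists p.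
Qed.

Lemma transition_C2 (c d : chart M) (p : M) i : cdom c p -> cdom d p ->
  differentiable (fun x => 'D_(delta_mx 0 i) (phi d \o psi c) x) (phi c p).
Proof.
by move=> cp dp; apply: (proj1 (proj2 (transition_smooth c d 2) i)); exists p.
Qed.

Lemma tangent_coordE (p : M) c (v : tangent p) :
  tangent_coord c v = sdiff (phi c \o psi (chart_at p)) (phi (chart_at p) p) v.
Proof. by rewrite sdiffE. Qed.

Lemma tangent_coord_change (p : M) c d (v : tangent p) : cdom c p -> cdom d p ->
  tangent_coord d v = sdiff (phi d \o psi c) (phi c p) (tangent_coord c v).
Proof.
move=> cp dp; rewrite !tangent_coordE; set e := chart_at p.
have ep : cdom e p by exact: chart_at_dom.
have dec := nbhs_singleton (transition_diff ep cp).
have dcd := nbhs_singleton (transition_diff cp dp).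
have cE : (phi c \o psi e) (phi e p) = phi c p by rewrite /= phiK.
have [ded dE] := sdiff_comp cE dec dcd.
have [|_ H] := near_eq_differentiable (g := phi d \o psi e) _ ded.
  have cn : nbhs p (cdom c) by apply: open_nbhs_nbhs; split => //; exact: open_cdom.
  apply: filterS (chart_nbhs ep cn) => x [_ cx _] /=; by rewrite phiK.
by rewrite H dE.
Qed.

Lemma tangent_coord_own (p : M) (v : tangent p) : tangent_coord (chart_at p) v = v.
Proof.
rewrite tangent_coordE; set e := chart_at p.
have ep : cdom e p by exact: chart_at_dom.
have did : differentiable (@id 'rV[R]_N) (phi e p) by apply: ex_diff.
have [|_ H] := near_eq_differentiable (g := phi e \o psi e) _ did.
  by apply: filterS (near_transition ep ep) => x [q [cq _] <-] /=; rewrite phiK.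
by rewrite H sdiff_funE diff_val.
Qed.

Lemma vf_coordE (X : vfield M) c (p : M) : cdom c p ->
  vf_coord X c (phi c p) = tangent_coord c (X p).
Proof. by move=> cp; rewrite /vf_coord phiK. Qed.

Lemma vf_coord_change (X : vfield M) c d (p : M) : cdom c p -> cdom d p ->
  \forall x \near phi c p,
    vf_coord X d ((phi d \o psi c) x) = sdiff (phi d \o psi c) x (vf_coord X c x).
Proof.
move=> cp dp; apply: filterS (near_transition cp dp) => x [q [cq dq] <-] /=.
by rewrite phiK // !vf_coordE // (tangent_coord_change (X q) cq dq).
Qed.

Lemma tangent_coord_sum (p : M) c (P : pred 'I_N) (a : 'I_N -> R) (v : 'I_N -> tangent p) :
  tangent_coord c (\sum_(i | P i) a i *: (v i : 'rV[R]_N) : tangent p) =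
  \sum_(i | P i) a i *: tangent_coord c (v i).
Proof.
rewrite tangent_coordE sdiff_sum; apply: eq_bigr => i _; by rewrite sdiffZ -tangent_coordE.
Qed.

Section Fields.
Variables (W : set M).
Hypothesis oW : open W.

Lemma vf_C1_near (X : vfield M) c (p : M) : vf_C1 W X -> cdom c p -> W p ->
  (\forall x \near phi c p, differentiable (vf_coord X c) x) /\
  (forall i, {for phi c p, continuous (fun x => 'D_(delta_mx 0 i) (vf_coord X c) x)}).
Proof.
move=> XC cp Wp; have [dX cX] := XC c; split; last by move=> i; apply: (cX i); exists p.
have Wn : nbhs p W by apply: open_nbhs_nbhs.
apply: filterS (chart_nbhs cp Wn) => x [cx Wx xE]; apply: dX.
by exists (psi c x).
Qed.

(** The bracket at [p] is defined in the preferred chart at [p]; in any other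
    chart it is given by the same formula. *)
Lemma lie_bracket_coord (X Y : vfield M) c (p : M) : vf_C1 W X -> vf_C1 W Y ->
  cdom c p -> W p ->
  tangent_coord c (lie_bracket X Y p) =
  sdiff (vf_coord Y c) (phi c p) (vf_coord X c (phi c p)) -
  sdiff (vf_coord X c) (phi c p) (vf_coord Y c (phi c p)).
Proof.
move=> XC YC cp Wp; set d := chart_at p.
have dp : cdom d p by exact: chart_at_dom.
have dif Z e : vf_C1 W Z -> cdom e p -> differentiable (vf_coord Z e) (phi e p).
  by move=> ZC ep; exact: nbhs_singleton (vf_C1_near ZC ep Wp).1.
have E : (phi c \o psi d) (phi d p) = phi c p by rewrite /= phiK.
have XC' : differentiable (vf_coord X c) ((phi c \o psi d) (phi d p)) by rewrite E; exact: dif.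
have YC' : differentiable (vf_coord Y c) ((phi c \o psi d) (phi d p)) by rewrite E; exact: dif.
have := bracket_pushforward (transition_diff dp cp) (fun i => @transition_C1 d c p i dp cp)
  (fun i => @transition_C2 d c p i dp cp) (vf_coord_change X dp cp) (vf_coord_change Y dp cp)
  (dif X d XC dp) (dif Y d YC dp) XC' YC'.
rewrite E => ->; rewrite tangent_coordE -/d; congr sdiff.
rewrite /lie_bracket -/d; congr (_ - _).
  by rewrite derive_sdiff ?vf_coordE ?tangent_coord_own //; exact: dif.
by rewrite derive_sdiff ?vf_coordE ?tangent_coord_own //; exact: dif.
Qed.

Lemma integral_curve_chart (V : vfield M) (g : R -> M) c (t : R) :
  integral_curve W V g -> 0 <= t <= 1 -> cdom c (g t) ->
  has_deriv (phi c \o g) t (tangent_coord c (V (g t))).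
Proof.
move=> gV t01 ct; have [Wt gt dg] := gV t t01.
set e := chart_at (g t) in dg *.
have et : cdom e (g t) by exact: chart_at_dom.
have en : nbhs (g t) (cdom e) by apply: open_nbhs_nbhs; split => //; exact: open_cdom.
apply: (@near_eq_has_deriv _ _ ((phi c \o psi e) \o (fun s => phi e (g s)))).
  have H : \forall s \near t, cdom e (g s) := gt _ en.
  by apply: filterS H => s /= es; rewrite phiK.
rewrite tangent_coordE; apply: has_deriv_comp; first exact: has_deriv_is_derive.
exact: nbhs_singleton (transition_diff et ct).
Qed.

Variable X : 'I_N -> vfield M.

Definition chart_fields (c : chart M) (k : 'I_N) : 'rV[R]_N -> 'rV[R]_N := vf_coord (X k) c.

Lemma comb_coord c a (p : M) : cdom c p ->
  tangent_coord c (comb X a p) = frame_comb (chart_fields c) a (phi c p).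
Proof.
move=> cp; rewrite tangent_coord_sum; apply: eq_bigr => i _.
by rewrite /chart_fields vf_coordE.
Qed.

End Fields.
End Charts.

(** * Integral curves: confinement and continuous dependence *)
Section Flows.
Context {R : realType} {N : nat} (M : smooth_manifold R N).
Variables (W : set M) (X : 'I_N -> vfield M).
Hypothesis oW : open W.
Let n : R := N%:R.

(** Integral curves of the combination of the fields with coefficients [a], with
    their derivative in every chart. *)
Definition flow_line (a : 'rV[R]_N) (g : R -> M) : Prop :=
  forall t : R, 0 <= t <= 1 ->
  [/\ W (g t), {for t, continuous g} &
      forall c, cdom c (g t) ->
        has_deriv (phi c \o g) t (frame_comb (chart_fields X c) a (phi c (g t)))].

Lemma integral_flow_line a g : integral_curve W (comb X a) g -> flow_line a g.
Proof.
move=> H t t01; have [Wt gt _] := H t t01; split => // c ct.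
by rewrite -comb_coord //; exact: (integral_curve_chart H).
Qed.

Lemma has_deriv_affine (V : normedModType R) (g : R -> V) s k t d :
  has_deriv g (s + t * k) d -> has_deriv (fun x => g (s + x * k)) t (k *: d).
Proof.
move=> gd e e0; pose C := `|k| + 1; have C0 : 0 < C by rewrite ltr_wpDl.
have e1 : 0 < e / C by rewrite divr_gt0.
have [r r0 H] := near_distR (gd _ e1).
have r1 : 0 < r / C by rewrite divr_gt0.
have := near_dist (t : R^o) r1; apply: filterS => x xt.
have E : s + x * k - (s + t * k) = (x - t) * k by ring.
have xk : `|(x - t) * k| <= `|x - t| * C by rewrite normrM ler_wpM2l // lerDl.
have := H (s + x * k); rewrite E scalerA => /(_ _)/le_trans; apply.
  by rewrite (le_lt_trans xk) // -ltr_pdivlMr.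
by rewrite (le_trans (ler_wpM2l (ltW e1) xk)) // mulrCA divfK ?gt_eqF // mulrC.
Qed.

Lemma flow_line_restart a g (s t : R) : flow_line a g -> 0 <= s -> s <= t -> t <= 1 ->
  flow_line ((t - s) *: a) (fun x => g (s + x * (t - s))).
Proof.
move=> ga s0 st t1 x /andP[x0 x1].
have y01 : 0 <= s + x * (t - s) <= 1.
  rewrite addr_ge0 ?mulr_ge0 ?subr_ge0 //= (le_trans _ t1) //.
  by rewrite -lerBrDl ler_piMl // subr_ge0.
have [Wx gx gc] := ga _ y01; split => //.
  apply: (@continuous_comp _ _ _ (fun x : R => s + x * (t - s)) g) => //.
  exact (has_deriv_cvg (@has_deriv_line R R^o s (t - s) x)).
move=> c cx; rewrite frame_combZ.
exact: (@has_deriv_affine _ (phi c \o g) s (t - s) x _ (gc c cx)).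
Qed.

Definition chart_frame (u0 : M) (rho S L K : R) : Prop :=
  let c := chart_at u0 in
  frame_ball (chart_fields X c) (phi c u0) rho S L K /\
  forall x, `|x - phi c u0| <= rho -> [/\ cdom c (psi c x), W (psi c x) & phi c (psi c x) = x].

Lemma chart_frame_sub u0 rho rho' S L K : chart_frame u0 rho S L K -> 0 < rho' <= rho ->
  chart_frame u0 rho' S L K.
Proof.
move=> [H1 H2] rr; split; first exact: frame_ball_sub rr.
by move=> x xr; apply: H2; rewrite (le_trans xr) //; case/andP: rr.
Qed.

(** It is the image of a compact ball in a Hausdorff space. *)
Lemma chart_ball_closed u0 rho S L K : chart_frame u0 rho S L K ->
  closed [set p | cdom (chart_at u0) p /\ `|phi (chart_at u0) p - phi (chart_at u0) u0| <= rho].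
Proof.
move=> [_ H]; set c := chart_at u0 in H *.
have -> : [set p | cdom c p /\ `|phi c p - phi c u0| <= rho] =
    psi c @` [set x | `|x - phi c u0| <= rho].
  apply/seteqP; split => [p [cp pr]|p [x xr <-]] /=.
    by exists (phi c p) => //; rewrite phiK.
  by have [cx _ xE] := H x xr; rewrite xE.
apply: compact_closed; first exact: manifold_hausdorff.
apply: continuous_compact; last exact: closed_ball_rV_compact.
apply: continuous_in_subspaceT => x; rewrite inE /= => xr.
have [cx _ xE] := H x xr.
by apply: psi_continuous; exists (psi c x).
Qed.

(** A curve of speed less than [m] that starts at distance at least [m] from the
    boundary of the chart ball cannot leave it in unit time.  At a limit time
    the curve is still in the domain of the chart because the chart ball is
    closed in the manifold. *)
Lemma flow_line_confined u0 rho S L K a g m : chart_frame u0 rho S L K ->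
  let c := chart_at u0 in let x0 := phi c u0 in
  flow_line a g -> cdom c (g 0) -> n * S * `|a| < m -> `|phi c (g 0) - x0| + m <= rho ->
  forall t : R, 0 <= t <= 1 -> cdom c (g t) /\ `|phi c (g t) - phi c (g 0)| <= m * t.
Proof.
move=> cf c x0 ga c0 am mrho.
have [FB HB] := cf; have n0 : 0 <= n by exact: ler0n.
have m0 : 0 < m by rewrite (le_lt_trans _ am) // !mulr_ge0 // ltW // (fb_S FB).
pose P t := cdom c (g t) /\ `|phi c (g t) - phi c (g 0)| <= m * t.
have inB t : t <= 1 -> P t -> `|phi c (g t) - x0| <= rho.
  move=> t1 [_ Pt]; have H1 := ler_distD (phi c (g 0)) (phi c (g t)) x0.
  have : m * t <= m by rewrite ler_piMr // ltW.
  lra.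
have lip t : 0 <= t <= 1 -> cdom c (g t) -> `|phi c (g t) - x0| <= rho ->
    \forall s \near t, `|phi c (g s) - phi c (g t)| <= m * `|s - t|.
  move=> t01 ct tr; have [_ _ gd] := ga t t01.
  apply: (has_deriv_lip (gd c ct)).
  by rewrite (le_lt_trans (frame_comb_le FB _ tr)).
apply: (@real_induction R 0 1 P) => [|t /andP[t0 t1] H|t /andP[t0 t1] H].
- by split => //; rewrite subrr normr0 mulr0.
- have Pt : P t by apply: H; rewrite t0 lexx.
  have t01 : 0 <= t <= 1 by rewrite t0 ltW.
  have [_ gt _] := ga t t01.
  have cn : \forall s \near t, cdom c (g s).
    by apply: gt; apply: open_nbhs_nbhs; split; [exact: open_cdom|exact: Pt.1].
  apply: filterS (filterI cn (lip t t01 Pt.1 (inB _ (ltW t1) Pt))) => s [cs Hs] /andP[ts _].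
  split => //; rewrite (le_trans (ler_distD (phi c (g t)) _ _)) //.
  rewrite gtr0_norm ?subr_gt0 // in Hs.
  by rewrite (le_trans (lerD Hs Pt.2)) // -mulrDr subrK.
- have t01 : 0 <= t <= 1 by rewrite ltW.
  have [_ gt _] := ga t t01.
  have [ct tr] : cdom c (g t) /\ `|phi c (g t) - x0| <= rho.
    apply: (@closed_cvg _ _ (t^'-) _ g _ (chart_ball_closed cf)) => /=.
      near=> s; have s0 : 0 <= s by near: s; exact: nbhs_left_ge.
      have st : s < t by [].
      have Ps : P s by apply: H; rewrite s0.
      by split; [exact: Ps.1|apply: inB => //; rewrite ltW // (lt_le_trans st)].
    apply: cvg_trans gt; apply: cvg_app; exact: cvg_within.
  have [r r0 Hr] := near_distR (lip t t01 ct tr).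
  split => //.
  pose s := Num.max 0 (t - r / 2).
  have s0 : 0 <= s by rewrite le_max lexx.
  have st : s < t by rewrite gt_max t0 /=; lra.
  have rs : t - r / 2 <= s by rewrite le_max lexx orbT.
  have Ps : P s by apply: H; rewrite s0.
  have := Hr s; rewrite distrC gtr0_norm ?subr_gt0 //.
  move=> Hs; have {}Hs := Hs ltac:(lra).
  rewrite (le_trans (ler_distD (phi c (g s)) _ _)) //.
  by rewrite distrC (le_trans (lerD Hs Ps.2)) // -mulrDr subrK.
Unshelve. all: by end_near. Qed.

(** The coordinates in a basis are a linear, hence bounded, function of the vector. *)
Lemma basis_row_bound (b : 'I_N -> 'rV[R]_N) :
  basis_of fullv [seq b k | k : 'I_N <- enum 'I_N] ->
  exists2 K, 0 < K & forall z : 'rV[R]_N, `|z| <= K * `|\sum_k z 0 k *: b k|.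
Proof.
move=> /basis_free.
have -> : [seq b k | k : 'I_N <- enum 'I_N] = [tuple b k | k < N] by [].
move=> /freeP fr.
pose A : 'M[R]_N := \matrix_k b k.
have bE (z : 'rV[R]_N) : \sum_k z 0 k *: b k = z *m A.
  rewrite mulmx_sum_row; apply: eq_bigr => i _; congr (_ *: _).
  by apply/rowP => j; rewrite !mxE.
have uA : A \in unitmx.
  rewrite -row_free_unit -kermx_eq0; apply/eqP/row_matrixP => i; rewrite row0.
  apply/rowP => j; rewrite [RHS]mxE; apply: (fr (fun k => row i (kermx A) 0 k)).
  under eq_bigr do rewrite -tnth_nth tnth_mktuple.
  by rewrite bE -row_mul mulmx_ker row0.
have [C C0 HC] : exists2 C, 0 < C & forall k, `|row k (invmx A)| <= C.
  apply: (@uniform_pos _ _ (fun k C => `|row k (invmx A)| <= C)).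
    by move=> k; exists (`|row k (invmx A)| + 1); rewrite ?ltr_wpDl ?lerDl.
  by move=> k l l' ll' H; apply: le_trans ll'.
exists (N.+1%:R * C); first by rewrite mulr_gt0.
move=> z; rewrite bE -{1}[z](mulmxK uA) mulmx_sum_row (le_trans (norm_sumZ_le _ HC)) //.
by rewrite ler_wpM2r // ler_wpM2r ?(ltW C0) // ler_nat.
Qed.

Lemma chart_frame_exists u0 : (forall k, vf_C1 W (X k)) ->
  basis_of fullv [seq (X k u0 : 'rV[R]_N) | k : 'I_N <- enum 'I_N] -> W u0 ->
  exists rho S L K, chart_frame u0 rho S L K.
Proof.
move=> XC bas Wu; set c := chart_at u0.
have cu : cdom c u0 by exact: chart_at_dom.
have Wn : nbhs u0 W by apply: open_nbhs_nbhs.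
have Wx := chart_nbhs cu Wn.
have [K0 K00 HK0] := basis_row_bound bas.
have [||S [L [K [rho FB]]]] := @frame_ball_exists R N (chart_fields X c) (phi c u0) K0 _ K00.
- move=> k; apply: filterS Wx => x [cx Wx <-].
  exact: (vf_C1_near oW (XC k) cx Wx).
- move=> z; rewrite /frame_comb /chart_fields; under eq_bigr do rewrite vf_coordE // tangent_coord_own.
  exact: HK0.
have [r r0 Hr] := iffLR (near_distP _ _) Wx.
pose rho' := Num.min rho (r / 2).
have rho'0 : 0 < rho' by rewrite lt_min (fb_rho FB) divr_gt0.
exists rho', S, L, K; split.
  by apply: (frame_ball_sub FB); rewrite rho'0 ge_min lexx.
move=> x xr; apply: Hr; rewrite (le_lt_trans xr) // gt_min orbC ltr_pdivrMr //.
by rewrite ltr_pMr // ltr1n.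
Qed.

Section Continuity.
Hypothesis frame : forall p, W p -> exists rho S L K, chart_frame p rho S L K.

(** Continuous dependence of the time-one point on the initial point and on the
    coefficients, stated for the relation between both so that it also contains
    the uniqueness of integral curves. *)
Let cont_flow (a1 : 'rV[R]_N) (u1 v1 : M) := forall V, nbhs v1 V ->
  \forall u \near u1 & a \near a1, forall g, flow_line a g -> g 0 = u -> V (g 1).

(** Curves with small coefficients stay in one chart ball, where [curves_close]
    applies. *)
Lemma flow_continuous_local p : W p -> exists2 al, 0 < al & \forall u1 \near p,
  forall a1 g1, `|a1| < al -> flow_line a1 g1 -> g1 0 = u1 -> cont_flow a1 u1 (g1 1).
Proof.
move=> /frame[rho [S [L [K cf]]]]; set c := chart_at p.
have [FB HB] := cf; set x0 := phi c p in FB HB.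
have rho0 := fb_rho FB; have S0 := fb_S FB; have L0 := fb_L FB.
have n0 : 0 <= n by exact: ler0n.
have n10 : 0 < n + 1 by rewrite ltr_wpDl.
pose al := Num.min (rho / (8 * (n + 1) * S)) (1 / (2 * (n + 1) * L)).
have al0 : 0 < al by rewrite lt_min !divr_gt0 // !mulr_gt0.
have cp : cdom c p by exact: chart_at_dom.
have alS (a : 'rV[R]_N) : `|a| < al -> n * S * `|a| < rho / 4.
  rewrite lt_min ltr_pdivlMr ?mulr_gt0 // => /andP[H _].
  have : n * S * `|a| <= `|a| * ((n + 1) * S).
    by rewrite mulrC ler_wpM2l // ler_wpM2r ?(ltW S0) // lerDl.
  lra.
have alL (a : 'rV[R]_N) : `|a| < al -> n * L * `|a| <= 1 / 2.
  rewrite lt_min [X in _ && X]ltr_pdivlMr ?mulr_gt0 // => /andP[_ H].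
  have : n * L * `|a| <= `|a| * ((n + 1) * L).
    by rewrite mulrC ler_wpM2l // ler_wpM2r ?(ltW L0) // lerDl.
  lra.
pose A := [set u | cdom c u /\ `|phi c u - x0| < rho / 4].
have An : nbhs p A.
  have r40 : 0 < rho / 4 by rewrite divr_gt0.
  apply: filterI; first by apply: open_nbhs_nbhs; split => //; exact: open_cdom.
  exact (phi_continuous cp (near_dist x0 r40)).
have oA u : A u -> nbhs u A.
  move=> [cu ur]; have r40 : 0 < rho / 4 - `|phi c u - x0| by rewrite subr_gt0.
  have H1 : nbhs u (cdom c) by apply: open_nbhs_nbhs; split => //; exact: open_cdom.
  have H2 : nbhs u [set v | `|phi c v - phi c u| < rho / 4 - `|phi c u - x0|].
    exact (phi_continuous cu (near_dist (phi c u) r40)).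
  apply: filterS (filterI H1 H2) => v [cv /= vu]; split => //.
  have := ler_distD (phi c u) (phi c v) x0; lra.
have conf a g : `|a| < al -> flow_line a g -> A (g 0) -> forall t : R, 0 <= t <= 1 ->
   cdom c (g t) /\ `|phi c (g t) - x0| <= rho.
  move=> aal ga [c0 g0] t t01.
  have [|ct gt] := flow_line_confined cf ga c0 (alS a aal) _ t01; first by rewrite -/c -/x0; lra.
  split => //; have := ler_distD (phi c (g 0)) (phi c (g t)) x0.
  have : rho / 4 * t <= rho / 4.
    by have /andP[_ t1] := t01; rewrite ler_piMr // divr_ge0 // ltW.
  lra.
exists al => //; apply: filterS An => u1 Au1 a1 g1 a1al ga1 g10 V Vn.
rewrite -g10 in Au1.
have [c1 _] := conf a1 g1 a1al ga1 Au1 1 ltac:(by rewrite ler01 lexx).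
have [e e0 He] := iffLR (near_distP _ _) (chart_nbhs c1 Vn).
have e8 : 0 < e / 8 by rewrite divr_gt0.
have e8' : 0 < e / (8 * (n + 1) * S) by rewrite divr_gt0 // !mulr_gt0.
have al1 : 0 < al - `|a1| by rewrite subr_gt0.
have cu1 : cdom c u1 by rewrite -g10; exact: Au1.1.
exists (A `&` [set u | `|phi c u - phi c u1| < e / 8],
        [set a | `|a - a1| < al - `|a1| /\ `|a - a1| < e / (8 * (n + 1) * S)]).
  split; first apply: filterI.
  - by apply: oA; rewrite -g10.
  - exact (phi_continuous cu1 (near_dist (phi c u1) e8)).
  - exact (filterI (near_dist a1 al1) (near_dist a1 e8')).
move=> [u a] [/= [Au ue] [aal ae]] g ga g0.
have a_al : `|a| < al by have := ler_distD a1 a 0; rewrite !subr0; lra.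
rewrite -g0 in Au.
have [cg _] := conf a g a_al ga Au 1 ltac:(by rewrite ler01 lexx).
suff : `|phi c (g 1) - phi c (g1 1)| < e by move=> /He[_]; rewrite phiK.
have curve b h : `|b| < al -> flow_line b h -> A (h 0) -> forall t : R, 0 <= t <= 1 ->
    `|phi c (h t) - x0| <= rho /\ has_deriv (phi c \o h) t (frame_comb (chart_fields X c) b (phi c (h t))).
  move=> bal hb h0 t t01; have [ct rt] := conf b h bal hb h0 t t01; split => //.
  by have [_ _ H] := hb t t01; exact: H.
have one01 : ((0 : R) <= 1) && ((1 : R) <= 1) by rewrite ler01 lexx.
have := curves_close FB (alL _ a1al) (curve _ _ a1al ga1 Au1) (curve _ _ a_al ga Au) one01.
rewrite /= g10 g0 => H.
have : n * S * `|a - a1| <= e / 8.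
  move/ltW: ae; rewrite ler_pdivlMr ?mulr_gt0 //.
  have : n * S * `|a - a1| <= `|a - a1| * ((n + 1) * S).
    by rewrite mulrC ler_wpM2l // ler_wpM2r ?(ltW S0) // lerDl.
  lra.
lra.
Qed.

(** A long curve crosses many charts: the property at time [s] implies it at any
    close time [t], as the piece between [s] and [t], run at unit time, has small
    coefficients. *)
Lemma flow_continuous a0 g0 : flow_line a0 g0 -> cont_flow a0 (g0 0) (g0 1).
Proof.
move=> ga0.
pose P (t : R) := forall V, nbhs (g0 t) V ->
  \forall u \near g0 0 & a \near a0, forall g, flow_line a g -> g 0 = u -> V (g t).
have step s t al : 0 <= s -> s <= t -> t <= 1 -> `|(t - s) *: a0| < al ->
   (forall a1 g1, `|a1| < al -> flow_line a1 g1 -> g1 0 = g0 s -> cont_flow a1 (g0 s) (g1 1)) ->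
   P s -> P t.
  move=> s0 st t1 aal loc Ps V Vn.
  have st0 : s + 0 * (t - s) = s by rewrite mul0r addr0.
  have st1 : s + 1 * (t - s) = t by rewrite mul1r addrC subrK.
  have g1l := flow_line_restart ga0 s0 st t1.
  have := loc _ _ aal g1l; rewrite /= st0 st1 => /(_ erefl V Vn)[[A B] /= [An Bn] AB].
  have [[A' B'] /= [A'n B'n] AB'] := Ps _ An.
  have scaleB : \forall a \near a0, B ((t - s) *: a).
    have [e e0 He] := iffLR (near_distP _ _) Bn.
    apply: filterS (near_dist a0 e0) => a ae; apply: He.
    rewrite -scalerBr normrZ (le_lt_trans _ ae) // ler_piMl // ger0_norm ?subr_ge0 //; lra.
  exists (A', B' `&` [set a | B ((t - s) *: a)]); first by split => //; exact: filterI.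
  move=> [u a] [/= A'u [B'a Ba]] g ga gu.
  have As : A (g s) by exact: (AB' (u, a) (conj A'u B'a) g ga gu).
  have := AB (g s, (t - s) *: a) (conj As Ba) _ (flow_line_restart ga s0 st t1).
  by rewrite /= st0 st1; apply.
have small (t : R) : 0 <= t <= 1 -> exists2 al, 0 < al & \forall s \near t, 
    forall a1 g1, `|a1| < al -> flow_line a1 g1 -> g1 0 = g0 s -> cont_flow a1 (g0 s) (g1 1).
  move=> t01; have [Wt gt _] := ga0 t t01.
  have [al al0 H] := flow_continuous_local Wt.
  by exists al => //; exact: (gt _ H).
have near_small (al t : R) : 0 < al -> \forall s \near t, `|(t - s) *: a0| < al /\ `|(s - t) *: a0| < al.
  move=> al0; have C0 : 0 < `|a0| + 1 by rewrite ltr_wpDl.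
  have H0 : 0 < al / (`|a0| + 1) by rewrite divr_gt0.
  have := near_dist (t : R^o) H0; apply: filterS => s.
  rewrite ltr_pdivlMr // => H.
  have : `|s - t| * `|a0| <= `|s - t| * (`|a0| + 1) by rewrite ler_wpM2l // lerDl.
  by rewrite !normrZ (distrC t s) => H2; split; lra.
suff : P 1 by [].
apply: (@real_induction R 0 1 P) => [|t /andP[t0 t1] H|t /andP[t0 t1] H|]; last by rewrite ler01 lexx.
- move=> V Vn; exists (V, setT) => /=; first by split => //; exact: filterT.
  by move=> [u a] [/= Vu _] g _ ->.
- have [al al0 loc] := small t ltac:(by rewrite t0 ltW).
  apply: filterS (near_small al t al0) => s [_ H2] /andP[ts s1].
  apply: (step t s al t0 (ltW ts) s1 H2 (nbhs_singleton loc)).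
  by apply: H; rewrite t0 lexx.
- have [al al0 loc] := small t ltac:(by rewrite ltW).
  have [r r0 Hr] := near_distR (filterI loc (near_small al t al0)).
  pose s := Num.max 0 (t - r / 2).
  have s0 : 0 <= s by rewrite le_max lexx.
  have st : s < t by rewrite gt_max t0 /=; lra.
  have rs : t - r / 2 <= s by rewrite le_max lexx orbT.
  have := Hr s; rewrite distrC gtr0_norm ?subr_gt0 //.
  move=> Hs; have [Hs1 [Hs2 _]] := Hs ltac:(lra).
  by apply: (step s t al s0 (ltW st) t1 Hs2 Hs1); apply: H; rewrite s0.
Qed.

End Continuity.
End Flows.

(** * Euclidean balls of coefficients *)
Section Balls.
Context {R : realType} {N : nat}.

Lemma eball_norm (r : R) (a : 'rV[R]_N) : eball r a -> `|a| < r.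
Proof.
rewrite /eball /= => H; apply: le_lt_trans H.
apply: row_norm_le => [|i]; first exact: sqrtr_ge0.
rewrite -sqrtr_sqr; apply: ler_wsqrtr; rewrite (bigD1 i) //= lerDl.
by apply: sumr_ge0 => j _; exact: sqr_ge0.
Qed.

Lemma eball_sup (r : R) (a : 'rV[R]_N) : N.+1%:R * `|a| < r -> eball r a.
Proof.
move=> H; rewrite /eball /=; apply: le_lt_trans H.
have H0 : 0 <= N.+1%:R * `|a| by rewrite mulr_ge0.
rewrite -(ger0_norm H0) -sqrtr_sqr; apply: ler_wsqrtr.
rewrite (le_trans (y := \sum_(i < N) `|a| ^+ 2)) //.
  apply: ler_sum => i _; rewrite -real_normK ?num_real //.
  by rewrite lerXn2r ?nnegrE // row_norm_ge.
rewrite sumr_const card_ord -[leLHS]mulr_natl exprMn ler_wpM2r ?exprn_ge0 //.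
by rewrite -natrX ler_nat -mulnn (leq_trans (leqnSn N)) // leq_pmulr.
Qed.

Lemma eball_sub (r r' : R) : r <= r' -> eball r `<=` @eball R N r'.
Proof. by move=> rr a; rewrite /eball /= => /lt_le_trans; apply. Qed.

Lemma eball_open (r : R) (a : 'rV[R]_N) : eball r a -> \forall b \near a, eball r b.
Proof.
move=> ar.
have d : differentiable (fun b : 'rV[R]_N => \sum_(i < N) b 0 i ^+ 2) a.
  have -> : (fun b : 'rV[R]_N => \sum_(i < N) b 0 i ^+ 2) =
      \sum_(i < N) (fun b : 'rV[R]_N => b 0 i ^+ 2).
    by apply/funext => b; rewrite fct_sumE.
  apply: differentiable_sum => i.
  have -> : (fun b : 'rV[R]_N => b 0 i ^+ 2) =
      (fun b : 'rV[R]_N => b 0 i) * (fun b : 'rV[R]_N => b 0 i).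
    by apply/funext => b; rewrite expr2.
  by apply: differentiableM; exact: differentiable_coord.
have c := differentiable_continuous d.
have := @continuous_comp _ _ _ _ (@Num.sqrt R) a c (@sqrt_continuous R _).
move=> /(_ [set x | x < r]); apply.
by apply: open_nbhs_nbhs; split => //; exact: open_lt.
Qed.

End Balls.

(** * Coordinates relative to a point of U *)
Section Carnot.
Context {R : realType} {N : nat} (M : carnot_manifold R N).
Variables (W : set M) (X : 'I_N -> vfield M) (U : set M) (r : M -> R).
Hypotheses (oW : open W)
  (carnot : carnot_frame (hdim M) (depth M) W X (@HM R N M))
  (UW : U `<=` W) (domU : compact_domain U) (defU : dinfty_defined W X r U).
Let n : R := N%:R.
Let dg := deg (hdim M) (depth M) W X.
Local Notation T := (theta_coord W X r).

Lemma frame_at p : W p -> exists rho S L K, chart_frame W X p rho S L K.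
Proof.
by move=> Wp; apply: chart_frame_exists => //; [exact: carnot.1|have [] := carnot.2 p Wp].
Qed.

(** The bracket condition on the frame, read in the coordinates of one chart. *)
Lemma frame_bracket p rho S L K x : chart_frame W X p rho S L K ->
  let F := chart_fields X (chart_at p) in
  `|x - phi (chart_at p) p| <= rho -> forall k i l, (dg k + dg i < dg l)%N ->
  frame_coord F x (bracket F k i x) 0 l = 0.
Proof.
move=> [FB HB] F xr k i l kil; have [cx Wx xE] := HB x xr.
set c := chart_at p in FB HB F xr cx xE *.
have [_ _ [C HC] _] := carnot.2 _ Wx.
have := lie_bracket_coord oW (carnot.1 k) (carnot.1 i) cx Wx.
rewrite xE -[RHS]/(bracket F k i x) => <-.
rewrite HC tangent_coord_sum.
pose a : 'rV[R]_N := \row_m (if (dg m <= dg k + dg i)%N then C k i m else 0).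
have -> : \sum_(m < N | (dg m <= dg k + dg i)%N) C k i m *: tangent_coord c (X m (psi c x)) = frame_comb F a x.
  rewrite big_mkcond; apply: eq_bigr => m _; rewrite mxE.
  case: ifP => _; last by rewrite scale0r.
  by rewrite -vf_coordE // xE.
by rewrite (frame_combK FB) // mxE leqNgt kil.
Qed.

Lemma theta_flow u a : U u -> eball (r u) a ->
  exists g, [/\ flow_line W X a g, g 0 = u & g 1 = theta W X u a].
Proof.
move=> Uu ua; have [_ fl _ _] := defU Uu.
have : flow_to W (comb X a) u (theta W X u a).
  by have := xgetPex u (fl a ua).
by move=> [g [g1 g2 g3]]; exists g; split => //; exact: integral_flow_line.
Qed.

Lemma theta_coordP u v : U u -> U v -> eball (r u) (T u v) /\ theta W X u (T u v) = v.
Proof.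
move=> Uu Uv; have [_ _ _ sub] := defU Uu.
have [a ua av] := sub v Uv.
by have := @xgetPex _ 0 [set a | eball (r u) a /\ theta W X u a = v] (ex_intro _ a (conj ua av)).
Qed.

Lemma theta_coord_unique u a : U u -> eball (r u) a -> U (theta W X u a) ->
  T u (theta W X u a) = a.
Proof.
move=> Uu ua Uv; have [b1 b2] := theta_coordP Uu Uv.
have [_ _ [_ _ _ [g [gK _]]] _] := defU Uu.
by rewrite -(gK _ b1) b2 gK.
Qed.

Lemma coord_flow u v : U u -> U v ->
  exists g, [/\ flow_line W X (T u v) g, g 0 = u & g 1 = v].
Proof.
move=> Uu Uv; have [b1 b2] := theta_coordP Uu Uv.
by have [g] := theta_flow Uu b1; rewrite b2; exists g.
Qed.

(** A nonempty open subset of a manifold of positive dimension is not a point. *)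
Lemma other_point u0 : (0 < N)%N -> U u0 -> exists2 p, U p & p <> u0.
Proof.
move=> N0 Uu0; have [_ [D [oD [q Dq] _ UD]]] := domU.
have DU : D `<=` U by rewrite UD; exact: subset_closure.
have [qu|qu] := pselect (q = u0); last by exists q => //; exact: DU.
rewrite qu in Dq; set c := chart_at u0.
have cu : cdom c u0 by exact: chart_at_dom.
have Dn : nbhs u0 D by apply: open_nbhs_nbhs.
have [e e0 He] := iffLR (near_distP _ _) (chart_nbhs cu Dn).
pose v : 'rV[R]_N := const_mx (e / 2).
have vn : `|v| < e.
  rewrite (@le_lt_trans _ _ (e / 2)) ?ltr_pdivrMr ?ltr_pMr ?ltr1n //.
  by apply: row_norm_le => [|i]; rewrite ?mxE ?ger0_norm // divr_ge0 // ltW.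
have [cx Dx xE] := He (phi c u0 + v) ltac:(by rewrite addrAC subrr add0r).
exists (psi c (phi c u0 + v)); first exact: DU.
move=> E; rewrite E in xE.
have v0 : v = 0 by apply: (addrI (phi c u0)); rewrite addr0 -xE.
have := congr1 (fun w : 'rV[R]_N => w 0 (Ordinal N0)) v0; rewrite !mxE => /eqP.
by rewrite mulf_eq0 invr_eq0 !gt_eqF.
Qed.

Lemma near_chart (c : chart M) (p : M) e : cdom c p -> 0 < e ->
  \forall u \near p, cdom c u /\ `|phi c u - phi c p| < e.
Proof.
move=> cp e0; apply: filterI.
  by apply: open_nbhs_nbhs; split => //; exact: open_cdom.
exact (phi_continuous cp (near_dist (phi c p) e0)).
Qed.

(** The domain [U] contains a point [p] other than [u0].  It lies outside a small
    chart ball around [u0], and an integral curve from [u] to [p] with too small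
    coefficients could not leave that ball. *)
Lemma radius_lower_bound u0 : (0 < N)%N -> U u0 ->
  exists2 r0, 0 < r0 & \forall u \near u0, U u -> r0 <= r u.
Proof.
move=> N0 Uu0; have [p Up pu] := other_point N0 Uu0.
have [rho1 [S [L [K cf1]]]] := frame_at (UW Uu0); set c := chart_at u0 in cf1.
have cu : cdom c u0 by exact: chart_at_dom.
have [rho cf out] : exists2 rho, chart_frame W X u0 rho S L K &
    ~ (cdom c p /\ `|phi c p - phi c u0| <= rho).
  have rho10 := fb_rho cf1.1.
  have [cp|cp] := pselect (cdom c p); last by exists rho1 => // -[].
  have pos : 0 < `|phi c p - phi c u0|.
    rewrite normr_gt0 subr_eq0; apply/eqP => E; apply: pu.
    by rewrite -(phiK cp) E phiK.
  exists (Num.min rho1 (`|phi c p - phi c u0| / 2)).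
    by apply: chart_frame_sub cf1 _; rewrite lt_min rho10 divr_gt0 //= ge_min lexx.
  move=> [_]; rewrite le_min => /andP[_]; lra.
have rho0 := fb_rho cf.1; have S0 := fb_S cf.1.
have n10 : 0 < n + 1 by rewrite ltr_wpDl // ler0n.
exists (rho / (2 * (n + 1) * S)); first by rewrite divr_gt0 // !mulr_gt0.
have r20 : 0 < rho / 2 by rewrite divr_gt0.
apply: filterS (near_chart cu r20) => u [cuu ur] Uu; rewrite leNgt; apply/negP => rr.
apply: out; have [g [ga g0 g1]] := coord_flow Uu Up.
have [b1 _] := theta_coordP Uu Up.
have a_r : `|T u p| < rho / (2 * (n + 1) * S) by rewrite (lt_trans (eball_norm b1)).
rewrite -g0 in cuu ur.
have aS : n * S * `|T u p| < rho / 2.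
  move: a_r; rewrite ltr_pdivlMr ?mulr_gt0 // => H.
  have : n * S * `|T u p| <= `|T u p| * ((n + 1) * S).
    by rewrite mulrC ler_wpM2l // ler_wpM2r ?(ltW S0) // lerDl.
  lra.
have H2 : `|phi c (g 0) - phi c u0| + rho / 2 <= rho by lra.
have [c1 d1] := flow_line_confined cf ga cuu aS H2 (t := 1) ltac:(by rewrite ler01 lexx).
rewrite g1 -/c in c1 d1; split => //.
rewrite mulr1 in d1; have := ler_distD (phi c (g 0)) (phi c p) (phi c u0); lra.
Qed.

Lemma theta_inverse u : U u -> exists g : M -> 'rV[R]_N,
  forall b, eball (r u) b -> g (theta W X u b) = b /\
    {for theta W X u b, continuous g}.
Proof.
move=> Uu; have [_ _ [oI _ _ [g [gK gC]]] _] := defU Uu.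
exists g => b ub; split; first exact: gK.
set q := theta W X u b; set c := chart_at q.
have cq : cdom c q by exact: chart_at_dom.
have gd : differentiable (g \o psi c) (phi c q).
  by apply: (gC c).1; exists q => //; split => //; exists b.
have H := differentiable_continuous gd.
move=> V; rewrite -[g q]/(g q) => Vn.
have Vn' : nbhs ((g \o psi c) (phi c q)) V by rewrite /= phiK.
have H2 := H V Vn'.
have H3 : nbhs q [set p | V ((g \o psi c) (phi c p))] by exact (phi_continuous cq H2).
have cn : nbhs q (cdom c) by apply: open_nbhs_nbhs; split => //; exact: open_cdom.
by apply: filterS (filterI cn H3) => p [cp] /=; rewrite phiK.
Qed.

(** The image of the whole Euclidean ball is open, and the inverse map is
    continuous on it. *)
Lemma theta_open u b (V : set 'rV[R]_N) : U u -> eball (r u) b -> nbhs b V ->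
  nbhs (theta W X u b) (theta W X u @` V).
Proof.
move=> Uu ub Vn; have [_ _ [oI _ _ _] _] := defU Uu.
have [g gP] := theta_inverse Uu.
have In : nbhs (theta W X u b) (theta W X u @` eball (r u)).
  by apply: open_nbhs_nbhs; split => //; exists b.
have [gb gc] := gP b ub.
have gn : nbhs (theta W X u b) [set p | V (g p)] by apply: gc; rewrite gb.
by apply: filterS (filterI In gn) => _ [[a ua <-]] /=; rewrite (gP a ua).1 => Va; exists a.
Qed.

Lemma theta_closed u (C : set 'rV[R]_N) : U u -> C `<=` eball (r u) -> compact C ->
  closed (theta W X u @` C).
Proof.
move=> Uu Cu cC; have [_ _ [_ tc _ _] _] := defU Uu.
apply: compact_closed; first exact: manifold_hausdorff.
apply: continuous_compact => //; apply: continuous_in_subspaceT => x; rewrite inE => Cx.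
exact: tc (Cu x Cx).
Qed.

Lemma closed_left_limit (C : set M) (g : R -> M) (t : R) : closed C -> 0 < t ->
  {for t, continuous g} -> (forall s, 0 <= s < t -> C (g s)) -> C (g t).
Proof.
move=> cC t0 gt H.
apply: (@closed_cvg _ _ (t^'-) _ g _ cC) => /=.
  near=> s; apply: H; apply/andP; split; last by [].
  by near: s; exact: nbhs_left_ge.
apply: cvg_trans gt; apply: cvg_app; exact: cvg_within.
Unshelve. all: by end_near. Qed.

(** The case [r u < r u0] is immediate.  Otherwise the closed ball of radius [rho]
    around [a0] lies in the domain of [theta_u], the image of its boundary avoids a
    neighbourhood of [v0] and that of its centre lies in it.  On a segment from
    the latter to [v], inside a chart ball, being in the image of the open ball is
    an open condition because [theta_u] is open, and a closed one because a limit
    point lies in the image of the closed ball but not of its boundary. *)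
Lemma coord_bounded_at u0 v0 : U u0 -> U v0 ->
  \forall u \near u0 & v \near v0, U u -> U v -> `|T u v| < r u0.
Proof.
move=> U0 V0; set a0 := T u0 v0.
have [a0r a0v] := theta_coordP U0 V0.
have [rho2 rho20 Hrho] := iffLR (near_distP _ _) (eball_open a0r).
pose rho := rho2 / 2; have rho0 : 0 < rho by rewrite divr_gt0.
have inr b : `|b - a0| <= rho -> eball (r u0) b.
  by move=> H; apply: Hrho; rewrite (le_lt_trans H) // ltr_pdivrMr // ltr_pMr // ltr1n.
pose P (q : M * M) (a : 'rV[R]_N) := `|a - a0| = rho ->
  forall g, flow_line W X a g -> g 0 = q.1 -> g 1 <> q.2.
have cptB := @closed_ball_rV_compact R N a0 rho.
have JC := flow_continuous frame_at.
(* Uniformly over the sphere, no curve from a point near [u0] ends near [v0]. *)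
have {cptB}[[A O] /= [An On] AO] : \forall q \near filter_prod (nbhs u0) (nbhs v0),
    [set a | `|a - a0| <= rho] `<=` P q.
  move/compact_near_coveringP : cptB; apply => a /= ar.
  have [ar'|ar'] := ltP `|a - a0| rho.
    have pos : 0 < rho - `|a - a0| by rewrite subr_gt0.
    exists ([set b | `|b - a| < rho - `|a - a0|], setT).
      by split; [exact (near_dist a pos)|exact: filterT].
    move=> [b q] [/= ba _] br; have := ler_distD a b a0; rewrite br; lra.
  have aE : `|a - a0| = rho by apply/eqP; rewrite eq_le ar.
  have [g [ga g0 g1]] := theta_flow U0 (inr a ar).
  have ne : theta W X u0 a <> v0.
    move=> E; have := theta_coord_unique U0 (inr a ar).
    rewrite E => /(_ V0) aa0; move: aE; rewrite -aa0 -/a0 subrr normr0 => E0.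
    by rewrite -E0 ltxx in rho0.
  have hM := @manifold_hausdorff _ _ M; rewrite open_hausdorff in hM.
  have [|[A B] /= [Aa Bv] [oA oB AB]] := hM (theta W X u0 a) v0; first exact/eqP.
  rewrite !inE in Aa Bv.
  have An : nbhs (g 1) A by rewrite g1; apply: open_nbhs_nbhs.
  have [[A' C'] /= [A'n C'n] H] := JC _ _ ga A An.
  rewrite g0 in A'n.
  exists (C', A' `*` B).
    split => //; exists (A', B) => //; split => //; exact: open_nbhs_nbhs.
  move=> [b [u v]] [/= C'b [A'u Bv']] br h hb h0 h1.
  have Ah : A (h 1) by exact: (H (u, b) (conj A'u C'b) h hb h0).
  have ABv : (A `&` B) v by split => //; move: Ah; rewrite h1.
  by move/eqP: AB ABv => ->.
set c := chart_at v0; have cv0 : cdom c v0 by exact: chart_at_dom.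
have [e e0 He] := iffLR (near_distP _ _) (chart_nbhs cv0 On).
pose O' := [set p | cdom c p /\ `|phi c p - phi c v0| < e].
have O'n : nbhs v0 O' by exact: near_chart.
have [g0 [ga0 g00 g01]] := theta_flow U0 a0r.
have O'n1 : nbhs (g0 1) O' by rewrite g01 a0v.
have [[A' C'] /= [A'n C'n] H] := JC _ _ ga0 O' O'n1.
rewrite g00 in A'n.
exists (A `&` A', O'); first by split => //; exact: filterI.
move=> [u v] [/= [Au A'u] O'v] Uu Uv.
have [ru|ru] := ltP (r u) (r u0).
  by apply: lt_trans ru; apply: eball_norm; exact: (theta_coordP Uu Uv).1.
have inru b : `|b - a0| <= rho -> eball (r u) b by move=> /inr; apply: eball_sub.
have a0ru : eball (r u) a0 by apply: inru; rewrite subrr normr0 ltW.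
have avoid p b : O p -> `|b - a0| <= rho -> theta W X u b = p -> `|b - a0| < rho.
  move=> Op br bp; rewrite lt_neqAle br andbT; apply/eqP => bE.
  have [h [hb h0 h1]] := theta_flow Uu (inru b br).
  exact: (AO (u, p) (conj Au Op) b br bE h hb h0 (etrans h1 bp)).
suff : (theta W X u @` [set b | `|b - a0| < rho]) v.
  move=> [b br bv]; rewrite -bv theta_coord_unique // ?bv //.
    by apply: eball_norm; apply: inr; exact: ltW.
  by apply: inru; exact: ltW.
have O'0 : O' (theta W X u a0).
  have [h [ha h0 h1]] := theta_flow Uu a0ru; rewrite -h1.
  exact: (H (u, a0) (conj A'u (nbhs_singleton C'n)) h ha h0).
set w := theta W X u a0 in O'0.
pose y t := phi c w + t *: (phi c v - phi c w).
have yin t : 0 <= t <= 1 -> `|y t - phi c v0| < e.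
  by move=> t01; apply: segment_in_ball => //; [exact: O'0.2|exact: O'v.2].
have sc (t : R) : 0 <= t <= 1 -> {for t, continuous (psi c \o y)}.
  move=> t01; apply: continuous_comp.
    exact (has_deriv_cvg (has_deriv_line (phi c w) (phi c v - phi c w) t)).
  have [cy _ yE] := He _ (yin t t01).
  by apply: psi_continuous; exists (psi c (y t)).
pose Q t := (theta W X u @` [set b | `|b - a0| < rho]) (psi c (y t)).
have -> : v = psi c (y 1).
  by rewrite /y scale1r addrC subrK phiK //; exact: O'v.1.
apply: (@real_induction R 0 1 Q) => [|t /andP[t0 t1] IH|t /andP[t0 t1] IH|]; last by rewrite ler01 lexx.
- exists a0; first by rewrite /= subrr normr0.
  by rewrite /y scale0r addr0 phiK //; exact: O'0.1.
- have [b br bE] := IH t ltac:(by rewrite t0 lexx).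
  have bn : nbhs b [set b | `|b - a0| < rho].
    have pos : 0 < rho - `|b - a0| by rewrite subr_gt0.
    apply: filterS (near_dist b pos) => b' /= bb.
    have := ler_distD b b' a0; lra.
  have := theta_open Uu (inru b (ltW br)) bn; rewrite bE => Vn.
  have H2 : \forall s \near t, Q s by exact (sc t ltac:(by rewrite t0 ltW) _ Vn).
  by apply: filterS H2.
- have t01 : 0 <= t <= 1 by rewrite ltW.
  have cl := theta_closed Uu (C := [set b | `|b - a0| <= rho]) inru (@closed_ball_rV_compact R N a0 rho).
  have [|b br bE] := closed_left_limit cl t0 (sc t t01).
    move=> s s0t; have [b br bE] := IH s s0t; exists b => //; exact: ltW.
  exists b => //; apply: avoid bE => //.
  by have [_ + _] := He _ (yin t t01).
Qed.

Lemma coord_bounded u0 : U u0 -> \forall u \near u0, U u -> forall v, U v -> `|T u v| < r u0.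
Proof.
move=> Uu0; have [cU _] := domU.
have : \forall u \near nbhs u0, U `<=` (fun v => U u -> `|T u v| < r u0).
  move/compact_near_coveringP/near_covering_withinP : cU; apply => v Uv.
  have [[A B] [/= An Bn] H] := coord_bounded_at Uu0 Uv.
  exists (B, A); first by [].
  by move=> [v' u] [/= Bv Au] Uv' Uu; exact: (H (u, v')).
by apply: filterS => u H Uu v Uv; exact: H.
Qed.

Lemma scale_half (x y z t : R) : x != 0 -> x * (y * z / (2 * x) * t) = y / 2 * t * z.
Proof. by move=> x0; field. Qed.

(** * The estimate at small scale *)
Section LocalEstimate.
Variables (u0 : M) (rho S L K eta r0 : R).
Let c := chart_at u0.
Let x0 := phi c u0.
Hypotheses (cf : chart_frame W X u0 rho S L K) (eta0 : 0 < eta) (eta1 : eta <= 1).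
Hypotheses (eta_flow : 2 * n * L * eta <= 1)
  (eta_bracket : 8 * (n * n * (K * (2 * L * S)) * eta) <= 1)
  (eta_speed : n * S * eta < rho / 8) (eta_r : N.+1%:R * eta < r0).
Let ka := eta / 8.
Variables (u : M) (Uu : U u) (cu : cdom c u) (ur : `|phi c u - x0| < rho / 4) (r0u : r0 <= r u).
Variables (eps : R) (eps0 : 0 < eps) (eps1 : eps <= 1).
Local Notation wt := (weighted dg eps).

Let rho0 : 0 < rho. Proof. exact: fb_rho cf.1. Qed.
Let K0 : 0 < K. Proof. exact: fb_K cf.1. Qed.
Let S0 : 0 < S. Proof. exact: fb_S cf.1. Qed.
Let ka0 : 0 < ka. Proof. by rewrite divr_gt0. Qed.
Let ka_eta : ka + 4 * ka <= eta. Proof. by rewrite /ka; have := eta0; lra. Qed.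
Let wtle (a : 'rV[R]_N) : `|a| <= `|wt a|. Proof. exact: weighted_ge. Qed.

Lemma small_confined (a : 'rV[R]_N) g e : `|a| <= eta -> flow_line W X a g -> cdom c (g 0) ->
  `|phi c (g 0) - x0| < e -> e <= rho / 2 -> forall t : R, 0 <= t <= 1 ->
  cdom c (g t) /\ `|phi c (g t) - x0| < e + rho / 8.
Proof.
move=> ae ga c0 g0 er t t01.
have aS : n * S * `|a| < rho / 8.
  by rewrite (le_lt_trans _ eta_speed) // ler_wpM2l // mulr_ge0 ?ler0n // ltW.
have rho0' := rho0; have H : `|phi c (g 0) - x0| + rho / 8 <= rho by lra.
have [ct gt] := flow_line_confined cf ga c0 aS H t01.
split => //; have := ler_distD (phi c (g 0)) (phi c (g t)) x0.
have : rho / 8 * t <= rho / 8.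
  by have /andP[_ t1] := t01; rewrite ler_piMr // divr_ge0 // ltW.
lra.
Qed.

Lemma small_eball (a : 'rV[R]_N) : `|a| <= eta -> eball (r u) a.
Proof.
move=> ae; apply: eball_sup; rewrite (lt_le_trans _ r0u) // (le_lt_trans _ eta_r) //.
by rewrite ler_wpM2l.
Qed.

Lemma small_flow (a : 'rV[R]_N) : `|a| <= eta -> exists g, [/\ flow_line W X a g, g 0 = u, 
  g 1 = theta W X u a & forall t : R, 0 <= t <= 1 ->
   [/\ cdom c (g t), `|phi c (g t) - x0| < rho &
     has_deriv (phi c \o g) t (frame_comb (chart_fields X c) a (phi c (g t)))]].
Proof.
move=> ae; have [g [ga g0 g1]] := theta_flow Uu (small_eball ae).
exists g; split => // t t01; have rho0' := rho0.
have cg0 : cdom c (g 0) by rewrite g0.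
have gr : `|phi c (g 0) - x0| < rho / 4 by rewrite g0.
have [ct gt] := small_confined ae ga cg0 gr (ltac:(lra) : rho / 4 <= rho / 2) t01.
split => //; first lra.
by have [_ _ H] := ga t t01; exact: H.
Qed.

(** The homeomorphism [theta_u] lifts the path to coefficients [a'] close to [a], and
    [coefficients_le] compares the curves from [u] with coefficients [a] and [a'].
    Their end points [p s] and [p s'] differ by [(s' - s) b] in the frame, up to an
    error that is small even after division by the smallest weight. *)
Lemma lift_step (a b : 'rV[R]_N) (p : R -> M) s : `|wt a| <= 4 * ka -> `|wt b| <= ka ->
  theta W X u a = p s -> cdom c (p s) -> `|phi c (p s) - x0| <= rho ->
  {for s, continuous p} ->
  has_deriv (phi c \o p) s (frame_comb (chart_fields X c) b (phi c (p s))) ->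
  \forall s' \near s, s < s' -> exists a', theta W X u a' = p s' /\
    `|wt (a' - a)| <= 3 * ka * (s' - s).
Proof.
move=> aka bka ap cp pr pc pd.
have kaE : 8 * ka = eta by rewrite /ka; field.
have ka0' := ka0; have rho0' := rho0.
have aeta : `|a| <= eta by have := wtle a; lra.
have ua := small_eball aeta.
have [g [ga g0 g1 gin]] := small_flow aeta.
have aeta' : forall i, `|a 0 i| <= eta * eps ^+ dg i.
  by apply/(weighted_leP dg eps0 a (ltW eta0)); lra.
have [nu nu0 Hnu] := coefficients_le cf.1 eps0 eps1 (fun x => @frame_bracket _ _ _ _ _ x cf) eta0 eta1 eta_flow eta_bracket.
have [ginv ginvP] := theta_inverse Uu; have [gia gic] := ginvP a ua.
set m := (\max_l dg l)%N.
have em0 : 0 < eps ^+ m by rewrite exprn_gt0.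
have d0 : 0 < Num.min nu (ka * eps ^+ m) by rewrite lt_min nu0 mulr_gt0.
have e0 : 0 < ka * eps ^+ m / (2 * K) by rewrite divr_gt0 ?mulr_gt0.
have [_ _ [oI _ _ _] _] := defU Uu.
have In : nbhs (p s) (theta W X u @` eball (r u)).
  by apply: open_nbhs_nbhs; split => //; exists a.
have N1 : \forall s' \near s, (theta W X u @` eball (r u)) (p s') by exact (pc _ In).
have N2 : \forall s' \near s, `|ginv (p s') - a| < Num.min nu (ka * eps ^+ m).
  have gn : nbhs (ginv (theta W X u a)) [set y | `|y - a| < Num.min nu (ka * eps ^+ m)].
    by rewrite gia; exact (near_dist a d0).
  have H : nbhs (p s) [set q | `|ginv q - a| < Num.min nu (ka * eps ^+ m)].
    by have := gic _ gn; rewrite ap; exact.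
  exact (pc _ H).
apply: filterS (filterI (filterI N1 N2) (pd _ e0)) => s' [[[a' ua' a'p] +] pd'] ss'.
rewrite -a'p (ginvP a' ua').1 lt_min => /andP[a'nu a'ka].
exists a'; split => //.
have wa' : `|wt (a' - a)| <= ka.
  rewrite (le_trans (weighted_le dg eps0 eps1 _)) // ler_pdivrMr // ltW //.
have a'eta : `|a'| <= eta.
  have H1 := ler_normD (wt (a' - a)) (wt a).
  rewrite -weightedD subrK in H1.
  have H2 := lerD wa' aka.
  by rewrite (le_trans (wtle a')) // (le_trans H1) // (le_trans H2) //.
have [g' [ga' g'0 g'1 g'in]] := small_flow a'eta.
rewrite (_ : 3 * ka * (s' - s) = 2 * (3 / 2 * ka * (s' - s))); last by field.
apply: (Hnu a a' (phi c \o g) (phi c \o g')) => //.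
- by rewrite /= g0 g'0.
- by move=> t /gin[].
- by move=> t /g'in[ct rt dt]; split => //; exact: ltW.
rewrite /= g1 g'1 ap a'p.
set x := phi c (p s); set F := chart_fields X c.
have E : phi c (p s') - x = (s' - s) *: frame_comb F b x + (phi c (p s') - x - (s' - s) *: frame_comb F b x).
  by rewrite addrCA subrr addr0.
rewrite E frame_coordD frame_coordZ (frame_combK cf.1) //.
set err := _ - _ - _ in pd' *.
rewrite weightedD weightedZ.
have ss0 : 0 < s' - s by rewrite subr_gt0.
rewrite (le_trans (ler_normD _ _)) // normrZ gtr0_norm //.
have H1 : (s' - s) * `|wt b| <= (s' - s) * ka by rewrite ler_wpM2l // ltW.
have H2 : `|wt (frame_coord F x err)| <= ka / 2 * (s' - s).
  rewrite (le_trans (weighted_le dg eps0 eps1 _)) // ler_pdivrMr //.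
  rewrite (le_trans (frame_coord_le cf.1 _ pr)) // (le_trans (ler_wpM2l (ltW K0) pd')) //.
  by rewrite gtr0_norm // scale_half ?gt_eqF.
rewrite (_ : 3 / 2 * ka * (s' - s) = (s' - s) * ka + ka / 2 * (s' - s)); last by field.
exact: lerD.
Qed.

(** Real induction along the path [p] from [w] to [v].  The bound [3 ka s] keeps the
    lifted coefficients of weighted norm at most [4 ka], half of [eta], so that the
    lift never reaches the boundary of the ball where [theta_u] is defined; at a
    limit time it exists because [theta_u] maps the compact weighted ball to a
    closed set. *)
Lemma local_triangle w v : U w -> U v ->
  (forall i, `|T u w 0 i| <= ka * eps ^+ dg i) -> (forall i, `|T w v 0 i| <= ka * eps ^+ dg i) ->
  forall i, `|T u v 0 i| <= eps ^+ dg i.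
Proof.
move=> Uw Uv /(weighted_leP dg eps0 _ (ltW ka0)) aka /(weighted_leP dg eps0 _ (ltW ka0)) bka.
have kaE : 8 * ka = eta by rewrite /ka; field.
have ka0' := ka0; have rho0' := rho0.
set a := T u w in aka; set b := T w v in bka.
have aeta : `|a| <= eta by have := wtle a; lra.
have beta : `|b| <= eta by have := wtle b; lra.
have [g [ga g0 g1]] := coord_flow Uu Uw.
have [p [pb p0 p1]] := coord_flow Uw Uv.
have cg0 : cdom c (g 0) by rewrite g0.
have gr : `|phi c (g 0) - x0| < rho / 4 by rewrite g0.
have one01 : ((0 : R) <= 1) && ((1 : R) <= 1) by rewrite ler01 lexx.
have [cw wr] := small_confined aeta ga cg0 gr (ltac:(lra) : rho / 4 <= rho / 2) one01.
rewrite g1 -p0 in cw wr.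
have pin (t : R) : 0 <= t <= 1 -> cdom c (p t) /\ `|phi c (p t) - x0| <= rho.
  move=> t01; have [ct pt] := small_confined beta pb cw wr (ltac:(lra) : rho / 4 + rho / 8 <= rho / 2) t01.
  by split => //; lra.
pose Q s := exists a', theta W X u a' = p s /\ `|wt (a' - a)| <= 3 * ka * s.
have wtD := weightedD dg eps.
have small4 s a' : s <= 1 -> `|wt (a' - a)| <= 3 * ka * s -> `|wt a'| <= 4 * ka.
  move=> s1 H; rewrite -[a'](subrK a) wtD (le_trans (ler_normD _ _)) //.
  have : 3 * ka * s <= 3 * ka by rewrite ler_piMr // mulr_ge0 // ltW.
  lra.
have wt0 : wt 0 = 0 by rewrite -(scale0r 0) weightedZ !scale0r.
have [a' [a'v a'w]] : Q 1.
  apply: (@real_induction R 0 1 Q) => [|s /andP[s0 s1] IH|s /andP[s0 s1] IH|]; last by rewrite ler01 lexx.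
  - by exists a; split; [rewrite p0; exact: (theta_coordP Uu Uw).2|rewrite subrr wt0 normr0 mulr0].
  - have s01 : 0 <= s <= 1 by rewrite s0 ltW.
    have [a' [a's a'w]] := IH s ltac:(by rewrite s0 lexx).
    have [cs ps] := pin s s01; have [_ pc pd] := pb s s01.
    have := lift_step (small4 _ _ (ltW s1) a'w) bka a's cs ps pc (pd c cs).
    apply: filterS => s' H /andP[ss' _]; have [a'' [a''s a''w]] := H ss'.
    exists a''; split => //; rewrite (_ : a'' - a = (a'' - a') + (a' - a)); last by rewrite addrA subrK.
    by rewrite wtD (le_trans (ler_normD _ _)) //; lra.
  - have s01 : 0 <= s <= 1 by rewrite ltW.
    pose C := [set a' | `|wt (a' - a)| <= 3 * ka * s].
    have Cu : C `<=` eball (r u).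
      move=> a' Ca'; apply: small_eball; have := wtle a'; have := small4 _ _ s1 Ca'; lra.
    have Cc : compact C by exact: weighted_ball_compact.
    have [_ pc _] := pb s s01.
    have [|a' Ca' a's] := closed_left_limit (theta_closed Uu Cu Cc) s0 pc.
      move=> s' /[dup] s's /andP[s'0 ss']; have [a' [a's a'w]] := IH s' s's.
      exists a' => //; rewrite /C /= (le_trans a'w) // ler_wpM2l ?mulr_ge0 ?(ltW ka0) // ltW //.
    by exists a'.
rewrite p1 in a'v; have a'4 := small4 _ _ (lexx 1) a'w.
have a'eta : `|a'| <= eta by have := wtle a'; lra.
have Tuv : T u v = a' by rewrite -a'v theta_coord_unique ?a'v //; exact: small_eball.
move=> i; rewrite Tuv -[leRHS]mul1r; move: i; apply/(weighted_leP dg eps0 _ ler01).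
by have := ka_eta; have := eta1; lra.
Qed.

End LocalEstimate.

(** * The quasimetric *)
Lemma dinfty_ge0 u v : 0 <= dinfty W X r u v.
Proof. by rewrite /dinfty; elim/big_ind: _ => // x y x0 y0; rewrite le_max x0. Qed.

Lemma dinfty_le u v D : 0 <= D -> (forall i, `|T u v 0 i| <= D ^+ dg i) ->
  dinfty W X r u v <= D.
Proof.
move=> D0 H; apply/bigmax_leP; split => // i _.
have d0 : (dg i)%:R != 0 :> R by rewrite pnatr_eq0.
rewrite (le_trans (ge0_ler_powR _ _ _ (H i))) ?nnegrE ?invr_ge0 ?exprn_ge0 //.
by rewrite -powR_mulrn // -powRrM mulfV // powRr1.
Qed.

Lemma dinfty_coord u v i : `|T u v 0 i| <= dinfty W X r u v ^+ dg i.
Proof.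
have d0 : (dg i)%:R != 0 :> R by rewrite pnatr_eq0.
rewrite -[leLHS](powRr1 (normr_ge0 _)) -(mulVf d0) powRrM powR_mulrn ?powR_ge0 //.
rewrite lerXn2r ?nnegrE ?powR_ge0 ?dinfty_ge0 // /dinfty.
exact: (le_bigmax _ (fun i => `|T u v 0 i| `^ (dg i)%:R^-1)).
Qed.

(** The inverse of the sum of all the quantities to be dominated. *)
Lemma small_eta (rho S L K r0 : R) : 0 < rho -> 0 < S -> 0 < L -> 0 < K -> 0 < r0 ->
  exists eta, [/\ 0 < eta <= 1, 2 * n * L * eta <= 1,
    8 * (n * n * (K * (2 * L * S)) * eta) <= 1, n * S * eta < rho / 8 &
    N.+1%:R * eta < r0].
Proof.
move=> rho0 S0 L0 K0 r00; have n0 : 0 <= n by exact: ler0n.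
pose A1 := 2 * n * L; pose A2 := 8 * (n * n * (K * (2 * L * S))).
pose A3 := 16 * n * S / rho; pose A4 := 2 * N.+1%:R / r0.
have A10 : 0 <= A1 by rewrite !mulr_ge0 // ltW.
have A20 : 0 <= A2 by rewrite !mulr_ge0 // ltW.
have A30 : 0 <= A3 by rewrite divr_ge0 ?mulr_ge0 // ltW.
have A40 : 0 <= A4 by rewrite divr_ge0 ?mulr_ge0 // ltW.
pose A := 1 + A1 + A2 + A3 + A4.
have A0 : 0 < A by rewrite /A; lra.
have le1 x : x <= A -> x / A <= 1 by move=> xA; rewrite ler_pdivrMr // mul1r.
have H1 : A1 / A <= 1 by apply: le1; rewrite /A; lra.
have H2 : A2 / A <= 1 by apply: le1; rewrite /A; lra.
have H3 : A3 / A <= 1 by apply: le1; rewrite /A; lra.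
have H4 : A4 / A <= 1 by apply: le1; rewrite /A; lra.
exists A^-1; split.
- rewrite invr_gt0 A0 /= invf_le1 // /A; lra.
- by rewrite -/A1.
- by rewrite mulrA -/A2.
- have : 16 * n * S / A <= rho.
    rewrite (_ : 16 * n * S / A = rho * (A3 / A)); last by rewrite /A3; field; rewrite !gt_eqF.
    by rewrite ler_piMr // ltW.
  have : 16 * n * S / A = 16 * (n * S / A) by rewrite !mulrA.
  lra.
- have : 2 * N.+1%:R / A <= r0.
    rewrite (_ : 2 * N.+1%:R / A = r0 * (A4 / A)); last by rewrite /A4; field; rewrite !gt_eqF.
    by rewrite ler_piMr // ltW.
  have : 2 * N.+1%:R / A = 2 * (N.+1%:R / A) by rewrite mulrA.
  have : 0 < N.+1%:R / A by rewrite divr_gt0.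
  lra.
Qed.

(** At small scale the right-hand side [d] gives [eps] close to [d / ka], and
    [d^(deg i) <= (ka eps)^(deg i) <= ka eps^(deg i)]; at large scale [d >= ka] and
    [1 + r u0] bounds the left-hand side. *)
Lemma quasi_triangle_near u0 : (0 < N)%N -> U u0 ->
  \forall u \near u0 & Q \near +oo, U u -> forall w v, U w -> U v ->
    dinfty W X r u v <= Q * (dinfty W X r u w + dinfty W X r w v).
Proof.
move=> N0 Uu0.
have [rho [S [L [K cf]]]] := frame_at (UW Uu0).
have [FB _] := cf; have rho0 := fb_rho FB.
have [r0 r00 Hr0] := radius_lower_bound N0 Uu0.
have [eta [/andP[eta0 eta1] h1 h2 h3 h4]] := small_eta rho0 (fb_S FB) (fb_L FB) (fb_K FB) r00.
pose ka := eta / 8.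
have ka0 : 0 < ka by rewrite divr_gt0.
have ka1 : ka <= 1 by rewrite /ka; lra.
have r40 : 0 < rho / 4 by rewrite divr_gt0.
have ru0 : 0 < r u0 by have [] := defU Uu0.
pose B := (1 + r u0) / ka.
exists ([set u | (cdom (chart_at u0) u /\ `|phi (chart_at u0) u - phi (chart_at u0) u0| < rho / 4) /\
   ((U u -> r0 <= r u) /\ (U u -> forall v, U v -> `|T u v| < r u0))], [set Q | B <= Q]).
  split; last by exact: (nbhs_pinfty_ge (num_real B)).
  by apply: filterI; [exact (near_chart (chart_at_dom u0) r40)|apply: filterI; [exact Hr0|exact (coord_bounded Uu0)]].
move=> [u Q] [/= [[cu ur] [ru bu]] BQ] Uu w v Uw Uv.
set d1 := dinfty W X r u w; set d2 := dinfty W X r w v.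
have d10 : 0 <= d1 by exact: dinfty_ge0.
have d20 : 0 <= d2 by exact: dinfty_ge0.
have d0 : 0 <= d1 + d2 by rewrite addr_ge0.
rewrite (le_trans _ (ler_wpM2r d0 BQ)) // /B.
have [dka|dka] := ltP (d1 + d2) ka; last first.
  rewrite (@le_trans _ _ (1 + r u0)) //.
    apply: dinfty_le => [|i]; first by rewrite addr_ge0 // ltW.
    rewrite (le_trans (row_norm_ge _ i)) // (le_trans (ltW (bu Uu v Uv))) //.
    rewrite (@le_trans _ _ (1 + r u0)) ?lerDr // ler_eXnr // lerDl ltW //.
  rewrite -mulrA ler_peMr ?addr_ge0 ?(ltW ru0) // mulrC ler_pdivlMr // mul1r //.
rewrite (@le_trans _ _ ((d1 + d2) / ka)) //; last first.
  rewrite mulrAC ler_wpM2r ?invr_ge0 ?(ltW ka0) // ler_peMl // lerDl ltW //.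
apply/ler_addgt0Pr => e e0.
(* The term [e] makes [eps] positive when [u], [w] and [v] coincide. *)
pose eps := Num.min 1 ((d1 + d2) / ka + e).
have eps0 : 0 < eps by rewrite lt_min ltr01 ltr_wpDl // divr_ge0 // ltW.
have eps1 : eps <= 1 by rewrite ge_min lexx.
have dke : d1 + d2 <= ka * eps.
  rewrite /eps; case: (leP 1 ((d1 + d2) / ka + e)) => _; first by rewrite mulr1 ltW.
  by rewrite mulrDr (mulrC ka) divfK ?gt_eqF // lerDl mulr_ge0 // ltW.
have small x i : 0 <= x -> x <= d1 + d2 -> x ^+ dg i <= ka * eps ^+ dg i.
  move=> x0 xd; rewrite (@le_trans _ _ ((ka * eps) ^+ dg i)) //.
    have p0 : 0 <= ka * eps by rewrite mulr_ge0 // ltW.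
    by apply: lerXn2r; rewrite ?nnegrE // (le_trans xd).
  rewrite exprMn ler_wpM2r ?exprn_ge0 ?(ltW eps0) // ler_iXnr // ltW //.
rewrite (@le_trans _ _ eps) ?ge_min ?lexx ?orbT //.
apply: dinfty_le => [|i]; first exact: ltW.
have H1 j : `|T u w 0 j| <= ka * eps ^+ dg j.
  by rewrite (le_trans (dinfty_coord u w j)) // small // lerDl.
have H2 j : `|T w v 0 j| <= ka * eps ^+ dg j.
  by rewrite (le_trans (dinfty_coord w v j)) // small // lerDr.
exact: (local_triangle cf eta0 eta1 h1 h2 h3 h4 Uu cu ur (ru Uu) eps0 eps1 Uw Uv H1 H2).
Qed.

End Carnot.

Theorem mainTheorem4 (R : realType) (N : nat) (M : carnot_manifold R N)
    (W : set M) (X : 'I_N -> vfield M) (U : set M) (r : M -> R) :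
  open W ->
  carnot_frame (hdim M) (depth M) W X (@HM R N M) ->
  U `<=` W ->
  compact_domain U ->
  dinfty_defined W X r U ->
  exists Q : R, forall u w v : M, U u -> U w -> U v ->
    dinfty W X r u v <= Q * (dinfty W X r u w + dinfty W X r w v).
Proof.
move=> oW carnot UW domU defU.
have [N0|N0] := posnP N.
  exists 0 => u w v _ _ _; rewrite mul0r; apply/bigmax_leP; split => // i.
  by have := ltn_ord i; rewrite {2}N0.
have [cU _] := domU.
have : \forall Q \near +oo, U `<=` (fun u => forall w v, U w -> U v ->
    dinfty W X r u v <= Q * (dinfty W X r u w + dinfty W X r w v)).
  move/compact_near_coveringP/near_covering_withinP : cU; apply => u Uu.
  exact: (quasi_triangle_near oW carnot UW domU defU N0 Uu).
move=> /(@filter_ex _ _ _)[Q H]; exists Q => u w v Uu Uw Uv; exact: H.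
Qed.
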